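(* Let $\pi=(d_{1},\ldots,d_{n})$ be a non-increasing positive graphic sequence with $n$ even. Let $r,k,k'$ be non-negative integers with $r\leq k\leq d_{n}$, $k'\leq n-1-d_{1}$, $k'$ even and $r\equiv k\pmod 2$. Suppose $\mathcal{D}_{k}(\pi)=(d_1-k,\ldots,d_n-k)$ and $\pi'=(d_{1}+k',\ldots,d_{n}+k')$ are both graphic, and \[r\leq \max\Big\{\min\{k,4\},\frac{k+k'+3}{3}\Big\}.\] Then some realization $G$ of $\pi$ has a $k$-factor that contains $r$ pairwise edge-disjoint $1$-factors.
   Context: All graphs are finite and simple. A sequence is graphic if it is the degree sequence of some simple graph (a realization). Non-increasing means $d_1\ge\cdots\ge d_n$; positive means all $d_i\ge1$. A $k$-factor is a spanning $k$-regular subgraph; a $1$-factor is a perfect matching. *)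

(* Defs.v *)
From mathcomp Require Import all_boot.

Set Implicit Arguments.
Unset Strict Implicit.
Unset Printing Implicit Defensive.

Record sgraph (T : finType) := SGraph {
  adj :> rel T;
  adj_sym : symmetric adj;
  adj_irrefl : irreflexive adj
}.

Definition deg (T : finType) (G : sgraph T) (v : T) : nat := #|[set w | G v w]|.

(* The vertex set is 'I_n; the entry of [d] at index i is the degree of vertex
   i, so index i (from 0) stands for the vertex carrying d_(i+1). *)
Definition realizes (n : nat) (G : sgraph 'I_n) (d : n.-tuple nat) : Prop :=
  [tuple deg G i | i < n] = d.

Definition graphic (n : nat) (d : n.-tuple nat) : Prop :=
  exists G : sgraph 'I_n, realizes G d.

(* Spanning is automatic: [H] and [G] share the vertex type [T]. *)
Definition is_factor (T : finType) (k : nat) (H G : sgraph T) : Prop :=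
  subrel H G /\ forall v : T, deg H v = k.

Definition edge_disjoint (T : finType) (G H : sgraph T) : Prop :=
  forall u v : T, ~~ (G u v && H u v).

(* Main.v *)
(** Let [K] be [k] or [k + k'].  By Kundu's theorem K_n splits into a graph R with
    degrees d_i - k, a K-regular graph, and the rest B.  Inside the K-regular part we
    extract perfect matchings one at a time, keeping a regular graph L of degree l
    besides the s matchings already found, and recolouring edges on the way.

    If no recolouring has a larger matching in L, a Gallai-Edmonds argument gives two
    odd connected sets X, Y of vertices, joined to the rest of L by fewer than l edges,
    such that any u in X, v in Y are missed by a common maximum matching of L.
    For two vertices x, y, the map w |-> (colour of xw, colour of yw) is a digraph on
    the colours; exchanging the edges at x and y along a directed cycle keeps all
    degrees, and a cycle through L can be used to enlarge the matching.  Hence the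
    colour R or B of an edge uv between X and Y decides how the R-degrees of the
    L-neighbours of u and v compare with those of v and u, and an edge and its
    L-neighbouring edge never have the same colour.  Starting from a vertex of largest
    R-degree, say in X, these rules propagate and split X into high and low vertices
    with L-edges only between the two classes, which is impossible for an odd set.

    Finally the regular graph left over has even degree, so that k' / 2 of its
    2-factors can be given back (Petersen). *)

Require Import Defs.
From mathcomp Require Import all_boot all_order all_algebra.
From mathcomp Require Import perm zify.
From Stdlib Require Import Classical_Prop.

Set Implicit Arguments.
Unset Strict Implicit.
Unset Printing Implicit Defensive.

(** * Matchings as involutions *)

Section Matchings.
Variable T : finType.
Implicit Types (E : rel T) (M N P : {ffun T -> T}) (A K : {set T}).

Definition matching E M :=
  [forall x, (M (M x) == x) && ((M x == x) || E x (M x))].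

Definition missed M := [set x | M x == x].

(** The deficiency of the graph: fixed points of a matching are its uncovered vertices. The
    identity, that is the empty matching, starts the minimum. *)
Definition unm E :=
  #|missed [arg min_(M < [ffun x => x] | matching E M) #|missed M|]|.

Definition optimal E M := matching E M && (#|missed M| <= unm E).

Lemma matchingP E M :
  reflect (involutive M /\ forall x, M x != x -> E x (M x)) (matching E M).
Proof.
apply: (iffP forallP) => [h|[h1 h2] x].
  split=> x; have /andP[/eqP h1 h2] := h x => //.
  by move=> ne; move: h2; rewrite (negbTE ne).
by rewrite h1 eqxx /=; case: eqVneq => //= ne; apply: h2.
Qed.

Lemma matching_id E : matching E [ffun x => x].
Proof. by apply/forallP=> x; rewrite !ffunE !eqxx. Qed.

Lemma unm_le E M : matching E M -> unm E <= #|missed M|.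
Proof.
by rewrite /unm; case: arg_minnP => [|N _ h]; [apply: matching_id | apply: h].
Qed.

Lemma exists_optimal E : exists M, optimal E M.
Proof.
rewrite /optimal /unm; case: arg_minnP => [|M h1 h2]; first exact: matching_id.
by exists M; rewrite h1 /=.
Qed.

(** Sorting the two ends of each matching edge by [enum_rank] splits the covered vertices into lower
    and upper ends, which [M] exchanges. *)
Lemma missed_parity E M : matching E M -> odd #|missed M| = odd #|T|.
Proof.
move=> /matchingP[Minv _].
pose P := [set x | enum_rank x < enum_rank (M x)].
pose Q := [set x | enum_rank (M x) < enum_rank x].
have cPQ : #|P| = #|Q|.
  rewrite -(card_imset _ (inv_inj Minv)); congr #|pred_of_set _|.
  apply/setP=> x; apply/imsetP/idP => [[y + ->]|].
    by rewrite !inE Minv.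
  by rewrite inE => h; exists (M x); rewrite ?inE Minv.
have U : [set: T] = missed M :|: (P :|: Q).
  apply/setP=> x; rewrite !inE; case: eqVneq => //= ne; apply/esym.
  case: ltngtP => // /ord_inj /enum_rank_inj e; by rewrite -e eqxx in ne.
have D1 : [disjoint P & Q].
  by apply/pred0P=> x; rewrite /= !inE; case: ltngtP.
have D2 : [disjoint missed M & P :|: Q].
  by apply/pred0P=> x; rewrite /= !inE; case: eqVneq => [->|] //=; rewrite ltnn.
rewrite -cardsT U cardsU (disjoint_setI0 D2) cards0 subn0.
rewrite cardsU (disjoint_setI0 D1) cards0 subn0 cPQ.
by rewrite oddD addnn odd_double addbF.
Qed.

Definition merge K N P : {ffun T -> T} := [ffun x => if x \in K then P x else N x].

Lemma merge_matching E K N P :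
  matching E N -> matching E P ->
  (forall x, x \in K -> N x \in K) -> (forall x, x \in K -> P x \in K) ->
  matching E (merge K N P).
Proof.
move=> /matchingP[N1 N2] /matchingP[P1 P2] NK PK; apply/matchingP.
have NK' x : x \notin K -> N x \notin K.
  by move=> xK; apply: contra xK => /NK; rewrite N1.
split=> x; rewrite !ffunE; case: (boolP (x \in K)) => xK.
- by rewrite PK.
- by rewrite (negbTE (NK' _ xK)).
- exact: P2.
- exact: N2.
Qed.

Lemma missed_merge K N P :
  #|missed (merge K N P)| = #|missed N :\: K| + #|missed P :&: K|.
Proof.
rewrite -(cardsID K) addnC; congr (_ + _); apply: eq_card => x.
  by rewrite !inE ffunE; case: ifP => //; rewrite ?andbF.
by rewrite !inE ffunE; case: ifP => //; rewrite ?andbF.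
Qed.

(* Follow the alternating path of N and M starting at v, that is, the orbit of v
   under M \o N; at most one of its vertices is missed by N. *)
Lemma exchange_missed E M N u v w :
  optimal E M -> optimal E N -> M v = v -> N u = u -> N w = w -> u != w ->
  exists P, optimal E P /\ P v = v /\ (P u = u \/ P w = w).
Proof.
move=> /andP[mM leM] /andP[mN leN] Mv Nu Nw uw.
have [[M1 M2] [N1 N2]] := (matchingP _ _ mM, matchingP _ _ mN).
pose f x := M (N x).
have injf : injective f by move=> x y /(inv_inj M1) /(inv_inj N1).
pose X := [set y | fconnect f v y].
have NX_of_MX y : M y \in X -> N y \in X.
  rewrite !inE => h; apply: connect_trans h _; rewrite fconnect_sym //.
  by rewrite -[M y]/(M y) (_ : M y = f (N y)) ?fconnect1 // /f N1.
have MX y : y \in X -> M y \in X.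
  rewrite inE => /iter_findex <-; elim: (findex _ _ _) => [|i IH] /=.
    by rewrite Mv inE.
  by rewrite /f M1; apply: NX_of_MX.
have NX y : y \in X -> N y \in X by move=> /MX; apply: NX_of_MX.
(* On the orbit of [v], [M] acts on indices as i -> -i and [N] as i -> -i-1, because [M] fixes
   [v]. *)
have itM i : iter i f (M (iter i f v)) = v.
  elim: i => [|i IH] //=; have ff y : f (M (f y)) = M y by rewrite /f M1 N1.
  by rewrite -iterS iterSr ff.
have itN i : iter i.+1 f (N (iter i f v)) = v.
  by rewrite iterSr -[f (N _)]/(M (N (N _))) N1 itM.
have per k : 0 < k < 2 * order f v -> iter k f v = v -> k = order f v.
  move=> /andP[k0 k2] e; case: (ltnP k (order f v)) => hk.
    by have := findex_iter hk; rewrite e findex0; lia.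
  have e2 : iter (k - order f v) f v = v.
    by move: e; rewrite -{1}(subnK hk) iterD (iter_order injf).
  have hk2 : k - order f v < order f v by lia.
  by have := findex_iter hk2; rewrite e2 findex0; lia.
(* A fixed point of [N] at index i has 2i+1 equal to the orbit length, so its index is
   determined. *)
have fixN y : y \in X -> N y = y -> (2 * findex f v y).+1 = order f v.
  rewrite inE => vy Ny; have lt := findex_max vy; apply: per; first lia.
  rewrite mul2n -addnn -addSn iterD iter_findex //.
  by have := itN (findex f v y); rewrite iter_findex // Ny.
have : (u \notin X) || (w \notin X).
  rewrite -negb_and; apply/negP=> /andP[uX wX].
  have e : findex f v u = findex f v w.
    by have := fixN u uX Nu; have := fixN w wX Nw; lia.
  move: uX wX; rewrite !inE => /iter_findex eu /iter_findex ew.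
  by move: uw; rewrite -eu -ew e eqxx.
move=> uwX; exists (merge X N M); split; last first.
  rewrite !ffunE inE connect0 Mv; split=> //.
  by case/orP: uwX => /negbTE->; [left|right].
(* The opposite merge is a matching as well, and the two merges together miss as many vertices as
   [M] and [N] together. *)
rewrite /optimal merge_matching //= missed_merge.
have := unm_le (merge_matching mM mN MX NX); rewrite missed_merge.
move: leM leN; rewrite -(cardsID X (missed M)) -(cardsID X (missed N)); lia.
Qed.

End Matchings.

(** * Gallai's lemma and the existence of a barrier *)

Section Barrier.
Variable T : finType.
Implicit Types (E : rel T) (M N P : {ffun T -> T}) (A K : {set T}).

Definition join N u w : {ffun T -> T} :=
  [ffun x => if x == u then w else if x == w then u else N x].

Definition split N a : {ffun T -> T} :=
  [ffun x => if (x == a) || (x == N a) then x else N x].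

Lemma join_matching E N u w :
  matching E N -> N u = u -> N w = w -> E u w -> E w u ->
  matching E (join N u w).
Proof.
move=> /matchingP[N1 N2] Nu Nw Euw Ewu; apply/matchingP.
have nu x : x != u -> N x != u by apply: contra => /eqP e; rewrite -(N1 x) e Nu.
have nw x : x != w -> N x != w by apply: contra => /eqP e; rewrite -(N1 x) e Nw.
have Ju : join N u w u = w by rewrite ffunE eqxx.
have Jw : join N u w w = u by rewrite ffunE eqxx; case: eqVneq.
have JN x : x != u -> x != w -> join N u w x = N x.
  by move=> /negbTE xu /negbTE xw; rewrite ffunE xu xw.
split=> x; have [->|xu] := eqVneq x u; rewrite ?Ju ?Jw //;
  have [->|xw] := eqVneq x w; rewrite ?Jw ?Ju //.
  by rewrite (JN x) // JN ?N1 ?nu ?nw.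
by rewrite JN //; apply: N2.
Qed.

Lemma missed_join N u w :
  N u = u -> N w = w -> u != w -> #|missed N| = #|missed (join N u w)| + 2.
Proof.
move=> Nu Nw uw; have wu : w != u by rewrite eq_sym.
have <- : missed N :\ u :\ w = missed (join N u w).
  apply/setP=> x; rewrite !inE ffunE.
  have [->|xw] /= := eqVneq x w; first by rewrite (negbTE wu) (negbTE uw).
  by have [->|xu] //= := eqVneq x u; rewrite (negbTE wu).
have uN : u \in missed N by rewrite inE Nu.
have wN : w \in missed N :\ u by rewrite !inE Nw wu eqxx.
by rewrite (cardsD1 u) uN (cardsD1 w (_ :\ u)) wN; lia.
Qed.

Lemma split_matching E N a : matching E N -> matching E (split N a).
Proof.
move=> /matchingP[N1 N2]; apply/matchingP.
have na x : x != N a -> N x != a by apply: contra => /eqP <-; rewrite N1.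
have nb x : x != a -> N x != N a by apply: contra => /eqP /(inv_inj N1) ->.
have Sa : split N a a = a by rewrite ffunE eqxx.
have Sb : split N a (N a) = N a by rewrite ffunE eqxx orbT.
have SN x : x != a -> x != N a -> split N a x = N x.
  by move=> /negbTE xa /negbTE xN; rewrite ffunE xa xN.
split=> x; have [->|xa] := eqVneq x a; rewrite ?Sa ?eqxx //;
  have [->|xN] := eqVneq x (N a); rewrite ?Sb ?eqxx //.
  by rewrite (SN x) // SN ?N1 ?na ?nb.
by rewrite SN //; apply: N2.
Qed.

Lemma missed_split E N a :
  matching E N -> #|missed (split N a)| = #|missed N| + 2 * (N a != a).
Proof.
move=> /matchingP[N1 _]; case: (eqVneq (N a) a) => [Na|Na] /=.
  rewrite muln0 addn0; apply: eq_card => x; rewrite !inE ffunE Na.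
  by have [->|] //= := eqVneq x a; rewrite Na !eqxx.
have aN : a != N a by rewrite eq_sym.
have <- : missed (split N a) :\ a :\ N a = missed N.
  apply/setP=> x; rewrite !inE ffunE.
  have [->|xN] /= := eqVneq x (N a); first by rewrite N1 (negbTE aN).
  by have [->|xa] //= := eqVneq x a; rewrite (negbTE Na).
have aS : a \in missed (split N a) by rewrite inE ffunE eqxx.
have bS : N a \in missed (split N a) :\ a by rewrite !inE ffunE Na eqxx orbT eqxx.
by rewrite (cardsD1 a) aS (cardsD1 (N a) (_ :\ a)) bS; lia.
Qed.

Lemma optimal_nonadj E N u w :
  symmetric E -> optimal E N -> N u = u -> N w = w -> u != w -> ~~ E u w.
Proof.
move=> sE /andP[mN leN] Nu Nw uw; apply/negP=> Euw.
have := unm_le (join_matching mN Nu Nw Euw (etrans (sE w u) Euw)).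
by move: leN; rewrite (missed_join Nu Nw uw); lia.
Qed.

(** In Gallai-Edmonds terms: every vertex is inessential. *)
Definition missable E := forall x, exists2 N, optimal E N & N x = x.

Definition cl E x := [set y | connect E x y].

Lemma cl_closed E N x y : matching E N -> y \in cl E x -> N y \in cl E x.
Proof.
move=> /matchingP[_ N2]; rewrite !inE => h; case: (eqVneq (N y) y) => [->//|ne].
by apply: connect_trans h (connect1 (N2 _ ne)).
Qed.

(** Gallai's lemma, by induction on a path from [x] to [y] with second vertex [v]. Exchanging [N]
    with a maximum matching missing [v] gives one that misses [v] and its neighbour [x], which is
    impossible, or [v] and [y], which are joined by a shorter path. *)
Lemma missed_cl_uniq E N x y :
  symmetric E -> missable E -> optimal E N -> N x = x -> N y = y ->
  y \in cl E x -> x = y.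
Proof.
move=> sE mE oN Nx Ny; rewrite inE => /connectP[p].
elim: p x N oN Nx Ny => [|v p IH] x N oN Nx Ny //= /andP[Exv pv] ely.
apply: contraTeq isT => /= xy; have vy : v != y.
  apply: contraL (optimal_nonadj sE oN Nx Ny xy) => /eqP <-; by rewrite negbK.
have [M oM Mv] := mE v.
have [P [oP [Pv [Px|Py]]]] := exchange_missed oM oN Mv Nx Ny xy.
  (* [E] may have loops here, so the path may begin by staying at [x]. *)
  case: (eqVneq x v) => [e|xv]; last first.
    by have := optimal_nonadj sE oP Px Pv xv; rewrite Exv.
  by have := IH v N oN; rewrite -e => /(_ Nx Ny); rewrite e => /(_ pv ely) /eqP; rewrite (negbTE vy).
by have /eqP := IH v P oP Pv Py pv ely; rewrite (negbTE vy).
Qed.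

(** The vertices of [A] stay as isolated vertices and count as missed, so all matchings live on one
    type. *)
Definition del E A : rel T := fun x y => [&& E x y, x \notin A & y \notin A].

Lemma del_sym E A : symmetric E -> symmetric (del E A).
Proof. by move=> sE x y; rewrite /del sE andbCA andbC -andbA andbCA !andbA andbAC. Qed.

Lemma del_matching E A N :
  matching (del E A) N = matching E N && [forall x in A, N x == x].
Proof.
apply/idP/andP=> [/matchingP[N1 N2]|[/matchingP[N1 N2] /forall_inP NA]].
  split; first by apply/matchingP; split=> // x /N2 /and3P[].
  by apply/forall_inP=> x xA; apply: contraTT xA => /N2 /and3P[].
apply/matchingP; split=> // x ne; rewrite /del N2 //=.
apply/andP; split; apply: contra ne => /NA //.
by rewrite N1 eq_sym.
Qed.

(** Dropping the matching edge at [x] uncovers only [x] and its partner. *)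
Lemma unm_del_step E A x : unm (del E (x |: A)) <= unm (del E A) + 2.
Proof.
have [N /andP[mN leN]] := exists_optimal (del E A).
apply: leq_trans (_ : #|missed (split N x)| <= _).
  apply: unm_le; move: (mN); rewrite !del_matching => /andP[mN' /forall_inP NA].
  rewrite split_matching //=; apply/forall_inP=> y; rewrite !inE ffunE.
  by case: (eqVneq y x) => //= _ /NA /eqP->; rewrite if_same eqxx.
by rewrite (missed_split _ mN); case: (_ != _); lia.
Qed.

Lemma sub_unm E E' :
  (forall M, matching E M -> matching E' M) -> unm E' <= unm E.
Proof.
by move=> sub; have [N /andP[/sub mN]] := exists_optimal E; apply: leq_trans (unm_le mN).
Qed.

Lemma unm_parity E : odd (unm E) = odd #|T|.
Proof.
have [N /andP[mN leN]] := exists_optimal E.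
by rewrite -(missed_parity mN); congr odd; have := unm_le mN; lia.
Qed.

(** Take a largest [A] with the equality. A further vertex [x] raises the deficiency by at most 2,
    by maximality not by exactly 2, and by parity not by 1. Hence a maximum matching after deleting
    [x] as well is still maximum for [A], and it misses [x]. *)
Lemma barrier E :
  exists A, unm (del E A) = unm E + 2 * #|A| /\ missable (del E A).
Proof.
pose Q := fun A => unm (del E A) == unm E + 2 * #|A|.
have Q0 : Q set0.
  have e M : matching (del E set0) M = matching E M.
    by rewrite del_matching; case: matching => //=; apply/forall_inP=> x; rewrite inE.
  rewrite /Q cards0 muln0 addn0 eqn_leq.
  by apply/andP; split; apply: sub_unm => M; rewrite e.
case: (arg_maxnP (fun A => #|A|) Q0) => A /eqP QA Amax; exists A; split=> // x.
have [xA|xA] := boolP (x \in A).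
  have [N oN] := exists_optimal (del E A); exists N => //.
  by move: oN => /andP[]; rewrite del_matching => /andP[_ /forall_inP /(_ x xA) /eqP].
have [N /andP[mN leN]] := exists_optimal (del E (x |: A)); exists N; last first.
  by move: mN; rewrite del_matching => /andP[_ /forall_inP /(_ x)/(_ (setU11 _ _)) /eqP].
apply/andP; split.
  move: mN; rewrite !del_matching => /andP[-> /forall_inP h] /=.
  by apply/forall_inP=> y yA; apply: h; rewrite inE yA orbT.
apply: leq_trans leN _.
have nQ : unm (del E (x |: A)) != unm E + 2 * #|x |: A|.
  by apply/negP=> /Amax; rewrite cardsU1 xA; lia.
have := unm_del_step E A x; have := unm_parity (del E (x |: A)).
rewrite -(unm_parity (del E A)) QA; move: nQ; rewrite cardsU1 xA; lia.
Qed.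

End Barrier.

(** * Components left by a barrier *)

Section SmallComponents.
Variables (T : finType) (E : rel T) (A : {set T}).
Hypotheses (sE : symmetric E) (unmA : unm (del E A) = unm E + 2 * #|A|).
Hypothesis missA : missable (del E A).
Implicit Types (N M : {ffun T -> T}).
Let D := del E A.
Let sD : symmetric D := del_sym A sE.

Definition restr N : {ffun T -> T} :=
  [ffun x => if (x \in A) || (N x \in A) then x else N x].

Lemma restr_matching N : matching E N -> matching D (restr N).
Proof.
move=> /matchingP[N1 N2]; rewrite del_matching; apply/andP; split; last first.
  by apply/forall_inP=> x xA; rewrite ffunE xA.
apply/matchingP; split=> x; rewrite !ffunE.
  case: (boolP ((x \in A) || (N x \in A))) => h; rewrite ?h //.
  by rewrite N1 orbC (negbTE h).
by case: ifPn => [|_]; [rewrite eqxx | apply: N2].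
Qed.

(** Cutting off [A] uncovers at most [A] and its image under [N], that is [2 * #|A|] new vertices,
    and all of these are needed to reach the deficiency. A vertex of [A] matched into [A], or
    uncovered, would make the count fall short. *)
Lemma restr_optimal N :
  optimal E N -> optimal D (restr N) /\ forall a, a \in A -> N a \notin A.
Proof.
move=> /andP[mN leN]; have mR := restr_matching mN.
have [N1 _] := matchingP _ _ mN.
have sub : missed (restr N) \subset missed N :|: (A :|: N @: A).
  apply/subsetP=> x; rewrite !inE ffunE; case: ifP => [/orP[->|NxA] _|_ ->//].
    by rewrite orbT.
  by rewrite -(N1 x) imset_f ?orbT.
have cN : #|N @: A| = #|A| by apply: card_imset; apply: inv_inj N1.
split.
  rewrite /optimal mR unmA; apply: leq_trans (subset_leq_card sub) _.
  by have := leq_card_setU (missed N) (A :|: N @: A); have := leq_card_setU A (N @: A);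
     move=> [+ _] [+ _]; lia.
move=> a aA; apply/negP=> NaA.
have sub2 : missed (restr N) \subset missed N :|: (A :|: N @: (A :\ a)).
  apply: subset_trans sub _; apply/subsetP=> x; rewrite !inE.
  case/or3P=> [->//|->|/imsetP[b bA ->]]; first by rewrite orbT.
  case: (eqVneq b a) => [->|ba]; first by rewrite NaA orbT.
  by rewrite imset_f ?orbT // !inE ba.
have := subset_leq_card sub2; have := unm_le mR; rewrite unmA.
have cN' : #|N @: (A :\ a)| = #|A :\ a| by apply: card_imset; apply: inv_inj N1.
have := leq_card_setU (missed N) (A :|: N @: (A :\ a)).
have := leq_card_setU A (N @: (A :\ a)).
by move=> [+ _] [+ _]; move: cN'; have := cardsD1 a A; rewrite aA; lia.
Qed.

Lemma restr_fix N x : N x = x -> restr N x = x.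
Proof. by move=> Nx; rewrite ffunE Nx if_same. Qed.

Lemma missed_notin N x : optimal E N -> N x = x -> x \notin A.
Proof. by move=> /restr_optimal[_ h] Nx; apply/negP=> /[dup] /h; rewrite Nx => /negP. Qed.

Lemma notin_cl N x a : optimal E N -> N x = x -> a \in A -> a \notin cl D x.
Proof.
move=> oN Nx aA; apply/negP=> ax; have [oR _] := restr_optimal oN.
have Ra : restr N a = a by rewrite ffunE aA.
have e := missed_cl_uniq sD missA oR (restr_fix Nx) Ra ax.
by have := missed_notin oN Nx; rewrite e aA.
Qed.

Lemma missed_cl_disjoint N x y :
  optimal E N -> N x = x -> N y = y -> x != y -> y \notin cl D x.
Proof.
move=> oN Nx Ny xy; apply: contra xy => h; have [oR _] := restr_optimal oN.
by rewrite (missed_cl_uniq sD missA oR (restr_fix Nx) (restr_fix Ny) h).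
Qed.

(** The component of [x] is stable under [N], since [x] is the only vertex in it missed by
    [restr N]. On it, [N] can be replaced by a maximum matching of [D] that misses [y]. *)
Lemma move_missed N x y :
  optimal E N -> N x = x -> y \in cl D x ->
  exists P, [/\ optimal E P, P y = y & forall z, z \notin cl D x -> P z = N z].
Proof.
move=> oN Nx yx; have [oR _] := restr_optimal oN.
have [M oM My] := missA y.
have [mM _] := andP oM; have [mN leN] := andP oN; have [mR _] := andP oR.
exists (merge (cl D x) N M); split; last 1 first.
- by move=> z /negbTE zx; rewrite ffunE zx.
- have clN z : z \in cl D x -> N z \in cl D x.
    move=> zx; have [Rz|Rz] := eqVneq (restr N z) z.
      by rewrite -(missed_cl_uniq sD missA oR (restr_fix Nx) Rz zx) Nx inE connect0.
    have := cl_closed mR zx; move: Rz; rewrite ffunE; case: ifP => //.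
    by rewrite eqxx.
  have mM' : matching E M by move: mM; rewrite del_matching => /andP[].
  rewrite /optimal merge_matching //=; last by move=> z; apply: cl_closed mM.
  rewrite missed_merge; move: leN; rewrite -(cardsID (cl D x) (missed N)).
  suff : #|missed M :&: cl D x| <= 1 /\ 0 < #|missed N :&: cl D x| by lia.
  split; last by rewrite card_gt0; apply/set0Pn; exists x; rewrite !inE Nx eqxx connect0.
  apply/card_le1_eqP => a b; rewrite !inE => /andP[/eqP Ma xa] /andP[/eqP Mb xb].
  apply: (missed_cl_uniq sD missA oM Mb Ma); rewrite inE.
  by apply: connect_trans xa; rewrite (sym_connect_sym sD).
- by rewrite ffunE yx.
Qed.

(** Move the uncovered vertex from [x] to [y], then rematch [a] with [y]: the former partner of [a]
    becomes uncovered. The other partners of [A] are kept so that rotations can be iterated. *)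
Lemma rotate_missed N x v a y :
  optimal E N -> N x = x -> N v = v -> x != v ->
  a \in A -> y \in cl D x -> E y a ->
  exists P, [/\ optimal E P, P (N a) = N a, P v = v &
    forall b, b \in A -> b != a -> P b = N b].
Proof.
move=> oN Nx Nv xv aA yx Eya.
have [M [oM My MN]] := move_missed oN Nx yx.
have MA b : b \in A -> M b = N b by move=> bA; rewrite MN // (notin_cl oN).
have Mv : M v = v by rewrite MN // (missed_cl_disjoint oN).
have [_ NA] := restr_optimal oN; have [mM leM] := andP oM.
have [M1 _] := matchingP _ _ mM.
have vA := missed_notin oN Nv; have yA := missed_notin oM My.
have ya : y != a by apply: contraNneq yA => ->.
have NaA := NA _ aA; have Naa : N a != a by apply: contraNneq NaA => ->.
have MNa : M (N a) = a by rewrite -MA.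
have Nay : N a != y by apply: contraNneq ya => e; rewrite -My -e MNa.
have Sa : split M a a = a by rewrite ffunE eqxx.
have Sy : split M a y = y by rewrite ffunE My if_same.
exists (join (split M a) y a); split.
- rewrite /optimal join_matching ?split_matching // 1?sE //=.
  rewrite -(leq_add2r 2) -(missed_join Sy Sa ya) (missed_split a mM) MA // Naa.
  by rewrite leq_add2r.
- by rewrite ffunE (negbTE Nay) (negbTE Naa) ffunE MA // eqxx orbT.
- rewrite ffunE; case: eqVneq => [e|_].
    by move: (missed_cl_disjoint oN Nx Nv xv); rewrite e yx.
  by case: eqVneq => [e|_]; [move: vA; rewrite e aA | rewrite ffunE Mv if_same].
- move=> b bA ba; rewrite ffunE (negbTE ba); case: eqVneq => [e|_].
    by move: yA; rewrite -e bA.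
  rewrite ffunE (negbTE ba) /= MA //; case: eqVneq => [e|_]; last exact: MA.
  by move: NaA; rewrite -e bA.
Qed.

(** A rotation that frees the partner of [a] can be followed by one at [b]. *)
Definition Astep N : rel T :=
  fun a b => (b \in A) && [exists y in cl D (N a), E y b].

Lemma rotate_path p N x v a :
  optimal E N -> N x = x -> N v = v -> x != v ->
  a \in A -> [exists y in cl D x, E y a] -> path (Astep N) a p -> uniq (a :: p) ->
  exists P, [/\ optimal E P, P (N (last a p)) = N (last a p) & P v = v].
Proof.
elim: p N x a => [|a' p IH] N x a oN Nx Nv xv aA /exists_inP[y yx Eya] /=.
  by have [P [? ? ? _]] := rotate_missed oN Nx Nv xv aA yx Eya; exists P.
move=> /andP[/andP[a'A ex] pth] /and3P[ap a'p up].
have [P [oP PNa Pv PA]] := rotate_missed oN Nx Nv xv aA yx Eya.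
have Nav : N a != v.
  apply: contraTneq aA => e; have [/matchingP[N1 _] _] := andP oN.
  by rewrite -(N1 a) e Nv (missed_notin oN).
(* The rotation at [a] changes no other partner in [A], and [a] does not recur, so the rest is still
   a path for [P]. *)
have sub b : b \in a' :: p -> b \in A -> P b = N b.
  by move=> bp bA; apply: PA => //; apply: contraNneq ap => <-.
have pA : all [in A] (a' :: p).
  rewrite /= a'A /=; elim: p a' pth {IH ap a'p up sub ex} a'A => //= c p IH a' /andP[/andP[cA _] pc] _.
  by rewrite cA (IH c).
have pth' : path (Astep P) a' p.
  apply: (@sub_in_path _ [in a' :: p] (Astep N)) pth; last by apply/allP.
  move=> b c bp cp /andP[cA h]; rewrite /Astep cA sub //.
  by apply: (allP pA).
have uq : uniq (a' :: p) by rewrite /= a'p.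
have [Q [oQ Qlast Qv]] := IH P (N a) a' oP PNa Pv Nav a'A ex pth' uq.
have lA := allP pA _ (mem_last a' p).
by exists Q; split=> //; rewrite -(sub _ (mem_last a' p) lA).
Qed.

Definition outdeg (C : {set T}) := \sum_(z in C) #|[set y | E z y] :\: C|.

(** Let [A1] be the part of [A] reachable from [x] by rotations. All edges leaving the components of
    [x] and of the partners of [A1] end in [A1]. These are [#|A1| + 1] disjoint components, but [A1]
    receives at most [l * #|A1|] edges, so one component sends out fewer than [l]; rotations bring
    the uncovered vertex there. *)
Lemma small_component N x v l :
  (forall z, #|[set y | E z y]| = l) -> 0 < l ->
  optimal E N -> N x = x -> N v = v -> x != v ->
  exists P y, [/\ optimal E P, P y = y, P v = v, y != v & outdeg (cl D y) < l].
Proof.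
move=> reg l0 oN Nx Nv xv.
have [oR NA] := restr_optimal oN; have [/matchingP[N1 _] _] := andP oN.
pose start a := (a \in A) && [exists y in cl D x, E y a].
pose A1 := [set a in A | [exists a0, start a0 && connect (Astep N) a0 a]].
pose R := x |: N @: A1.
have A1A a : a \in A1 -> a \in A by rewrite inE => /andP[].
have [ex|] := boolP [exists r in R, outdeg (cl D r) < l].
  have [r + lt] := exists_inP ex.
  rewrite !inE => /orP[/eqP er|/imsetP[a aA1 er]]; first by rewrite er in lt; exists N, x.
  rewrite er in lt; move: (aA1); rewrite inE => /andP[aA /existsP[a0 /andP[/andP[a0A st]]]].
  move=> /connectP[p pth]; case: (shortenP pth) => p' pth' up' _ la.
  have [P [oP Pl Pv]] := rotate_path oN Nx Nv xv a0A st pth' up'.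
  exists P, (N a); rewrite la; split=> //.
    apply: contraTneq aA => e.
    by rewrite -(N1 a) la e Nv (missed_notin oN).
  by rewrite -la.
rewrite negb_exists_in => /forall_inP big.
pose f z := \sum_(b in A1) (E z b : nat).
have sub r : r \in R -> outdeg (cl D r) <= \sum_(z in cl D r) f z.
  move=> rR; apply: leq_sum => z zr; rewrite /f -sum1_card big_mkcond [leqRHS]big_mkcond.
  apply: leq_sum => y _; rewrite in_setD inE [y \in [set _ | _]]inE.
  case: ifP => // /andP[nry Ezy].
  have rA : r \notin A.
    move: rR; rewrite !inE => /orP[/eqP->|/imsetP[a /A1A aA ->]].
      exact: missed_notin oN Nx.
    exact: NA.
  have zA : z \notin A.
    have Rr : restr N r = r.
      rewrite ffunE; move: rR; rewrite !inE => /orP[/eqP->|/imsetP[a /A1A aA ->]].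
        by rewrite Nx if_same.
      by rewrite N1 aA orbT.
    apply/negP=> zA; have Rz : restr N z = z by rewrite ffunE zA.
    by move: rA; rewrite (missed_cl_uniq sD missA oR Rr Rz zr) zA.
  have yA : y \in A.
    apply: contraNT nry => yA; move: zr; rewrite !inE => h.
    by apply: connect_trans h (connect1 _); rewrite /D /del Ezy zA yA.
  suff -> : y \in A1 by rewrite Ezy.
  rewrite inE yA /=; apply/existsP.
  move: rR; rewrite !inE => /orP[/eqP er|/imsetP[a]].
    by exists y; rewrite connect0 /start yA /= andbT; apply/exists_inP; exists z; rewrite -?er.
  rewrite inE => /andP[aA /existsP[a0 /andP[st con]]] er.
  exists a0; rewrite st; apply: connect_trans con (connect1 _); rewrite /Astep yA.
  by apply/exists_inP; exists z; rewrite -?er.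
have cR : #|R| = #|A1| + 1.
  rewrite cardsU1 card_imset; last exact: inv_inj N1.
  suff -> : x \notin N @: A1 by rewrite addnC.
  apply/negP=> /imsetP[a /A1A aA e]; have := NA a aA.
  by rewrite -e => _; move: (missed_notin oN Nx); rewrite -Nx e N1 aA.
have RN r : r \in R -> restr N r = r.
  rewrite ffunE !inE => /orP[/eqP->|/imsetP[a /A1A aA ->]]; first by rewrite Nx if_same.
  by rewrite N1 aA orbT.
have : \sum_(r in R) l <= \sum_z f z.
  apply: leq_trans (_ : \sum_(r in R) \sum_(z in cl D r) f z <= _).
    by apply: leq_sum => r rR; apply: leq_trans (sub r rR); rewrite leqNgt big.
  rewrite (exchange_big_dep predT) //=; apply: leq_sum => z _.
  rewrite sum_nat_cond_const; set n := #|_|.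
  suff : n <= 1 by case: n => [|[|]] //; rewrite mul1n.
  apply/card_le1_eqP=> a b; rewrite [in X in X -> _]inE [in X in _ -> X -> _]inE.
  rewrite [z \in cl D a]inE [z \in cl D b]inE => /andP[aR az] /andP[bR bz].
  apply: (missed_cl_uniq sD missA oR (RN _ bR) (RN _ aR)).
  by rewrite inE; apply: connect_trans bz _; rewrite (sym_connect_sym sD).
rewrite /f exchange_big sum_nat_const cR /=.
have -> : \sum_(b in A1) \sum_z (E z b : nat) = \sum_(b in A1) l.
  apply: eq_bigr => b _; rewrite -(reg b) -sum1_card [RHS]big_mkcond.
  by apply: eq_bigr => z _; rewrite inE sE; case: (E b z).
by rewrite sum_nat_const; move: l0; nia.
Qed.

End SmallComponents.

(** Here [a] counts the edges between two sides of sizes [h] and [w], and [p], [q] the edges leaving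
    them: l(h - w) = p - q is smaller than l in absolute value. *)
Lemma balanced_sides a p q l h w :
  a + p = l * h -> a + q = l * w -> p + q < l -> h = w.
Proof.
move=> e1 e2 lt; case: (ltngtP h w) => // /(leq_mul (leqnn l)); rewrite mulnS.
  by rewrite -e1 -e2; lia.
by rewrite -e1 -e2; lia.
Qed.

(** * Odd connected sets with few outgoing edges *)

Section TwoSmallComponents.
Variables (T : finType) (E : rel T).
Hypothesis sE : symmetric E.
Implicit Types (C X : {set T}).

(** Connectedness as a propagation principle for properties that spread along edges. *)
Definition connected_set C := forall X x,
  x \in X -> x \in C ->
  (forall y z, y \in X -> y \in C -> z \in C -> E y z -> z \in X) -> C \subset X.

Definition small_set l C :=
  [/\ exists x, x \in C, odd #|C|, outdeg E C < l & connected_set C].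

Lemma cl_connected A x : connected_set (cl (del E A) x).
Proof.
move=> X y yX yC cX; set D := del E A in yC cX *; have sD : symmetric D := del_sym A sE.
have clo : closed D [in X :&: cl D x].
  apply: intro_closed => [|a b Dab]; first exact: sym_connect_sym.
  rewrite !inE => /andP[aX xa]; have xb : connect D x b by apply: connect_trans xa (connect1 Dab).
  by rewrite xb andbT (cX a b) ?inE //; case/and3P: Dab.
apply/subsetP=> z; rewrite inE => xz.
have yz : connect D y z.
  by apply: connect_trans xz; rewrite (sym_connect_sym sD); rewrite inE in yC.
have : y \in [in X :&: cl D x] by rewrite unfold_in /= inE yX.
by rewrite (closed_connect clo yz) unfold_in /= inE => /andP[].
Qed.

(** A maximum matching missing [x] covers the rest of the component by edges inside it. *)
Lemma cl_odd A x : missable (del E A) -> odd #|cl (del E A) x|.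
Proof.
move=> mA; set D := del E A in mA *; have sD : symmetric D := del_sym A sE.
have [M oM Mx] := mA x; have [mM _] := andP oM.
have mP : matching D (merge (cl D x) [ffun x => x] M).
  apply: merge_matching (matching_id _) (mM) _ _ => y yx; first by rewrite ffunE.
  exact: cl_closed mM yx.
have := missed_parity mP; rewrite missed_merge.
have -> : missed M :&: cl D x = [set x].
  apply/setP=> y; rewrite !inE; apply/andP/eqP=> [[/eqP My xy]|->].
    by apply/esym; apply: (missed_cl_uniq sD mA oM Mx My); rewrite inE.
  by rewrite Mx eqxx connect0.
have -> : missed [ffun x => x] :\: cl D x = ~: cl D x.
  by apply/setP=> y; rewrite !inE ffunE eqxx andbT.
rewrite cards1 -(cardsC (cl D x)) !oddD.
by rewrite addbC; case: (odd #|~: _|); case: (odd #|cl _ _|).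
Qed.

(** Use [small_component] twice: move [x] while [v] stays uncovered, then move [v] while the new
    vertex does. Inside the two components reached, the uncovered vertices can be moved
    independently. *)
Lemma two_small_components l :
  (forall x, #|[set y | E x y]| = l) -> 0 < l -> ~~ odd #|T| -> 0 < unm E ->
  exists C1 C2, [/\ small_set l C1, small_set l C2 &
    forall u v, u \in C1 -> v \in C2 ->
    u != v /\ exists N, [/\ optimal E N, N u = u & N v = v]].
Proof.
move=> reg l0 evT pos.
have [A [unmA missA]] := barrier E; have [N oN] := exists_optimal E.
have sD := del_sym A sE.
have [x [v [Nx Nv xv]]] : exists x v, [/\ N x = x, N v = v & x != v].
  have [mN leN] := andP oN; have e : #|missed N| = unm E by have := unm_le mN; lia.
  have : 1 < #|missed N|.
    have := unm_parity E; rewrite e (negbTE evT); move: pos; by case: (unm E) => [|[|]].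
  move=> /card_gt1P[x [y [+ + xy]]]; rewrite !inE => /eqP Nx /eqP Ny.
  by exists x, y.
have [N1 [x1 [oN1 N1x N1v x1v out1]]] :=
  small_component sE unmA missA reg l0 oN Nx Nv xv.
have vx1 : v != x1 by rewrite eq_sym.
have [N2 [x2 [oN2 N2x N2v x21 out2]]] :=
  small_component sE unmA missA reg l0 oN1 N1v N1x vx1.
have small y : outdeg E (cl (del E A) y) < l -> small_set l (cl (del E A) y).
  move=> out; split=> //; [|exact: cl_odd | exact: cl_connected].
  by exists y; rewrite inE connect0.
exists (cl (del E A) x1), (cl (del E A) x2); split; [exact: small|exact: small|].
move=> a b ax bx.
have x12 : x1 != x2 by rewrite eq_sym.
have x2n := missed_cl_disjoint sE unmA missA oN2 N2v N2x x12.
have nab : a \notin cl (del E A) x2.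
  apply: contra x2n; rewrite !inE => h; rewrite inE in ax.
  by apply: connect_trans ax _; rewrite (sym_connect_sym sD).
split; first by apply: contraNneq nab => ->.
have nx12 := missed_cl_disjoint sE unmA missA oN2 N2x N2v x21.
have [P [oP Pa PN]] := move_missed sE unmA missA oN2 N2v ax.
have Px2 : P x2 = x2 by rewrite PN.
have [Q [oQ Qb QN]] := move_missed sE unmA missA oP Px2 bx.
by exists Q; split=> //; rewrite QN.
Qed.

(** In a loopless graph, twice the number of edges inside [C]. *)
Definition eI C := \sum_(x in C) #|[set y in C | E x y]|.

Hypothesis irE : irreflexive E.

Lemma eI_setD1 C x : x \in C -> eI C = eI (C :\ x) + 2 * #|[set y in C | E x y]|.
Proof.
move=> xC; rewrite /eI (bigD1 x) //=.
have -> : \sum_(i in C | i != x) #|[set y in C | E i y]| =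
          \sum_(i in C :\ x) (#|[set y in C :\ x | E i y]| + E i x).
  apply: eq_big => [i|i /andP[iC ix]]; first by rewrite !inE andbC.
  rewrite (cardsD1 x) !inE xC /= addnC; congr (_ + _); apply: eq_card => y.
  by rewrite !inE andbA.
rewrite big_split /=.
have -> : \sum_(i in C :\ x) (E i x : nat) = #|[set y in C | E x y]|.
  rewrite -sum1_card big_mkcond [RHS]big_mkcond; apply: eq_bigr => i _.
  by rewrite !inE sE; case: eqVneq => [->|] //=; rewrite ?irE ?andbF //; case: (i \in C) => //=; case: (E x i).
by lia.
Qed.

Lemma eI_even C : ~~ odd (eI C).
Proof.
move: {2}#|C| (erefl #|C|) => m; elim: m C => [|m IH] C cC.
  by rewrite (cards0_eq cC) /eI big_set0.
have /card_gt0P[x xC] : 0 < #|C| by rewrite cC.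
rewrite (eI_setD1 xC) oddD mul2n odd_double addbF IH //.
by move: cC; rewrite (cardsD1 x) xC => -[].
Qed.

(** Peel off vertices of inner degree at most [t] one after another. The contrapositive produces
    subsets of large minimum degree. *)
Lemma core C t :
  (forall J : {set T}, J \subset C -> (exists x, x \in J) ->
     exists2 x, x \in J & #|[set y in J | E x y]| <= t) ->
  eI C <= 2 * t * #|C|.
Proof.
move: {2}#|C| (erefl #|C|) => m; elim: m C => [|m IH] C cC sparse.
  by rewrite (cards0_eq cC) /eI big_set0.
have /card_gt0P[x0 x0C] : 0 < #|C| by rewrite cC.
have [|x xC le] := sparse C (subxx _); first by exists x0.
rewrite (eI_setD1 xC).
have cC' : #|C :\ x| = m by move: cC; rewrite (cardsD1 x) xC => -[].
have := IH _ cC'; rewrite cC cC' => /(_ _)/(leq_trans _) h.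
have : eI (C :\ x) <= 2 * t * m.
  apply: h => // J JC; apply: sparse; exact: subset_trans JC (subD1set _ _).
by move: le; nia.
Qed.

Lemma eI_outdeg C l :
  (forall x, #|[set y | E x y]| = l) -> eI C + outdeg E C = l * #|C|.
Proof.
move=> reg; rewrite /eI /outdeg -big_split mulnC -sum_nat_const /=.
apply: eq_bigr => x _; rewrite -(reg x) -(cardsID C [set y | E x y]); congr (_ + _).
by apply: eq_card => y; rewrite !inE andbC.
Qed.

(** A set of m vertices with 1 <= m <= l sends out at least m(l - m + 1) >= l edges. *)
Lemma card_lt_small C l :
  (forall x, #|[set y | E x y]| = l) -> 0 < #|C| -> outdeg E C < l -> l < #|C|.
Proof.
move=> reg C0 out; have := eI_outdeg C reg.
have : eI C <= \sum_(x in C) #|C|.-1.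
  apply: leq_sum => x xC; rewrite (cardsD1 x C) xC /=; apply: subset_leq_card.
  apply/subsetP=> y; rewrite !inE => /andP[-> Exy]; rewrite andbT.
  by apply: contraTneq Exy => ->; rewrite irE.
rewrite sum_nat_const; case: #|C| C0 => // c _ /=; nia.
Qed.

(* In a bipartition of a small set both sides have the same size, so it is even. *)
Lemma small_not_bipartite C (H : {set T}) l :
  (forall x, #|[set y | E x y]| = l) -> odd #|C| -> outdeg E C < l ->
  (forall x y, x \in C -> y \in C -> E x y -> (x \in H) != (y \in H)) -> False.
Proof.
move=> reg oC out bip.
pose CH := C :&: H; pose CW := C :\: H.
have cross : \sum_(x in CH) #|[set y in C | E x y]| = \sum_(x in CW) #|[set y in C | E x y]|.
  have e (P Q : {set T}) : (forall x y, x \in P -> (y \in C) && E x y = (y \in Q) && E x y) ->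
    \sum_(x in P) #|[set y in C | E x y]| = \sum_(x in P) \sum_(y in Q) (E x y : nat).
    move=> h; apply: eq_bigr => x xP; rewrite -sum1_card big_mkcond [RHS]big_mkcond.
    apply: eq_bigr => y _; rewrite inE h //; case: (y \in Q) => //=; by case: (E x y).
  rewrite (e CH CW); last first.
    move=> x y; rewrite !inE => /andP[xC xH]; case: (boolP (E x y)) => [Exy|]; rewrite ?andbF // !andbT.
    by case: (boolP (y \in C)) => yC; rewrite ?andbF // andbT; have := bip x y xC yC Exy; rewrite xH; case: (y \in H).
  rewrite (e CW CH); last first.
    move=> x y; rewrite !inE => /andP[xH xC]; case: (boolP (E x y)) => [Exy|]; rewrite ?andbF // !andbT.
    by case: (boolP (y \in C)) => yC //=; have := bip x y xC yC Exy; rewrite (negbTE xH); case: (y \in H).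
  by rewrite exchange_big; apply: eq_bigr => x _; apply: eq_bigr => y _; rewrite sE.
have deg (P : {set T}) : \sum_(x in P) #|[set y in C | E x y]| +
    \sum_(x in P) #|[set y | E x y] :\: C| = l * #|P|.
  rewrite -big_split mulnC -sum_nat_const /=.
  apply: eq_bigr => x _; rewrite -(reg x) -(cardsID C [set y | E x y]); congr (_ + _).
  by apply: eq_card => y; rewrite !inE andbC.
have := deg CH; have := deg CW.
have : \sum_(x in CH) #|[set y | E x y] :\: C| + \sum_(x in CW) #|[set y | E x y] :\: C| = outdeg E C.
  by rewrite /outdeg [RHS](bigID [in H]) /=; congr (_ + _); apply: eq_bigl => x; rewrite !inE // andbC.
move: oC; rewrite -(cardsID H C) -/CH -/CW cross.
move=> oC eo e1 e2; move: eo out => <- out.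
by move: oC; rewrite (balanced_sides e2 e1 out) addnn odd_double.
Qed.

End TwoSmallComponents.

(** * Edges between two deficient components *)

Lemma eq_mod3 h w x a b :
  3 * h = x + a -> 3 * w = x + b -> a + b <= 2 -> a = b.
Proof. by lia. Qed.

Section Clash.
Variables (T C : finType) (E : rel T) (c : T -> T -> C) (Ms : {set C}).
Hypotheses (sE : symmetric E) (irE : irreflexive E).
Hypothesis csym : forall x y, c x y = c y x.
Hypothesis Ms_inj : forall x y z,
  x != y -> x != z -> c x y \in Ms -> c x z = c x y -> y = z.
Implicit Types (r : T -> nat) (X Y J K : {set T}).

(** The rules that hold when no exchange enlarges the matching. Here [E] is the graph of colour L,
    [r] the R-degree, and [Ms] the noise: the colours of the matchings already found. *)
Record clash (R B : C) r X Y : Prop := Clash {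
  clash_neq : forall u v, u \in X -> v \in Y -> u != v;
  clash_colour : forall u v, u \in X -> v \in Y ->
    [|| c u v == R, c u v == B | c u v \in Ms];
  clash_R : forall u v, u \in X -> v \in Y -> c u v = R ->
    (forall w, E u w -> r w < r v) /\ (forall z, E v z -> r z < r u);
  clash_B : forall u v, u \in X -> v \in Y -> c u v = B ->
    (forall w, E u w -> r v < r w) /\ (forall z, E v z -> r u < r z);
  clash_T : forall u v w z, u \in X -> v \in Y -> w != z -> E u w -> E v z ->
    c w z != c u v }.

Lemma clash_sym R B r X Y : clash R B r X Y -> clash R B r Y X.
Proof.
case=> h1 h2 h3 h4 h5; split=> u v.
- by move=> uY vX; rewrite eq_sym h1.
- by move=> uY vX; rewrite csym h2.
- by move=> uY vX; rewrite csym => /(h3 _ _ vX uY)[].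
- by move=> uY vX; rewrite csym => /(h4 _ _ vX uY)[].
- by move=> w z uY vX wz Euw Evz; rewrite csym [c u v]csym; apply: h5; rewrite 1?eq_sym.
Qed.

(** R and B exchange their roles when the order of [r] is reversed; the bound [m] keeps the
    truncated subtraction strictly decreasing. *)
Lemma clash_dual R B r m X Y :
  (forall x, r x <= m) -> clash R B r X Y -> clash B R (fun x => m - r x) X Y.
Proof.
move=> le [h1 h2 h3 h4 h5].
have sub a b : r a < r b -> m - r b < m - r a by have := le b; lia.
split=> // u v uX vY; first by rewrite orbCA h2.
- by case/(h4 _ _ uX vY) => p q; split=> z e; apply: sub; auto.
- by case/(h3 _ _ uX vY) => p q; split=> z e; apply: sub; auto.
Qed.

Section Rows.
Variables (R B : C) (r : T -> nat) (X Y : {set T}).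
Hypothesis cXY : clash R B r X Y.

(** On [p z], R would put [w] below [z], and B would put [p] below a neighbour of [z] in [J]. On
    [w y], R would put [p] below [y], and B would put [w] below [z]. [clash_T] separates the two
    noise colours. *)
Lemma below_neighbour_noise J p w z :
  J \subset Y -> p \in X -> w \in X -> E p w -> (forall v, v \in J -> r v <= r p) ->
  z \in J -> r z < r w -> 0 < #|[set y in J | E z y]| ->
  c p z \in Ms /\ forall y, y \in J -> E z y -> c w y \in Ms :\ c p z.
Proof.
move=> JY pX wX Epw hp zJ zw /card_gt0P[y0]; rewrite inE => /andP[y0J Ezy0].
have zY := subsetP JY _ zJ; split.
  case/or3P: (clash_colour cXY pX zY) => // /eqP e.
    by have [/(_ w Epw)] := clash_R cXY pX zY e; rewrite ltnNge (ltnW zw).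
  by have [_ /(_ y0 Ezy0)] := clash_B cXY pX zY e; rewrite ltnNge hp.
move=> y yJ Ezy; have yY := subsetP JY _ yJ.
rewrite in_setD1 (clash_T cXY) ?(clash_neq cXY) //=.
case/or3P: (clash_colour cXY wX yY) => // /eqP e.
  have [/(_ p) + _] := clash_R cXY wX yY e; rewrite sE => /(_ Epw).
  by rewrite ltnNge hp.
by have [_ /(_ z)] := clash_B cXY wX yY e; rewrite sE => /(_ Ezy); rewrite ltnNge (ltnW zw).
Qed.

(** The edges from [w] to the neighbours of [z] in [J] carry distinct noise colours, none of them
    that of [p z]. *)
Lemma below_neighbour_card J p w z :
  J \subset Y -> p \in X -> w \in X -> E p w -> (forall v, v \in J -> r v <= r p) ->
  z \in J -> r z < r w -> 0 < #|[set y in J | E z y]| ->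
  #|[set y in J | E z y]| < #|Ms|.
Proof.
move=> JY pX wX Epw hp zJ zw pos.
have [kM lab] := below_neighbour_noise JY pX wX Epw hp zJ zw pos.
rewrite (cardsD1 (c p z) Ms) kM ltnS -(@card_in_imset _ _ (c w)).
  apply: subset_leq_card; apply/subsetP=> _ /imsetP[y + ->].
  by rewrite inE => /andP[yJ Ezy]; apply: lab.
move=> y y'; rewrite !inE => /andP[yJ Ey] /andP[y'J Ey'] e.
have [_ yM] := setD1P (lab y yJ Ey).
by apply: (Ms_inj _ _ yM) (esym e); apply: (clash_neq cXY) => //; apply: (subsetP JY).
Qed.

Lemma level_row J u :
  J \subset Y -> u \in X -> (forall v, v \in J -> c u v \in Ms) -> #|J| <= #|Ms|.
Proof.
move=> JY uX h; rewrite -(@card_in_imset _ _ (c u)).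
  by apply: subset_leq_card; apply/subsetP=> _ /imsetP[y yJ ->]; apply: h.
move=> y y' yJ y'J e; apply: (Ms_inj _ _ (h _ yJ)) (esym e);
by apply: (clash_neq cXY) => //; apply: (subsetP JY).
Qed.

End Rows.

(** By the degree bound in [J], the neighbours in [X] of a vertex lying above all of [J] lie below
    all of [J], and dually. Connectedness spreads this from [p] over [X], which becomes
    bipartite. *)
Lemma clash_core_high l R B r X Y J p :
  (forall x, #|[set y | E x y]| = l) ->
  clash R B r X Y -> small_set E l X -> J \subset Y -> (exists z, z \in J) ->
  (forall v, v \in J -> maxn #|Ms| 1 <= #|[set y in J | E v y]|) ->
  p \in X -> (forall v, v \in J -> r v <= r p) -> False.
Proof.
move=> reg cXY [_ oX outX conX] JY [z0 z0J] degJ pX hp.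
have nb v : v \in J -> 0 < #|[set y in J | E v y]|.
  by move=> /degJ; rewrite geq_max => /andP[].
have [m hm] : exists m, forall x, r x <= m.
  by exists (\max_x r x) => x; apply: leq_bigmax.
have cD := clash_dual hm cXY.
have low u w : u \in X -> w \in X -> E u w -> (forall v, v \in J -> r v <= r u) ->
    forall v, v \in J -> r w <= r v.
  move=> uX wX Euw hu v vJ; rewrite leqNgt; apply/negP=> lt.
  have := below_neighbour_card cXY JY uX wX Euw hu vJ lt (nb _ vJ).
  by rewrite ltnNge (leq_trans (leq_maxl _ 1) (degJ v vJ)).
have high u w : u \in X -> w \in X -> E u w -> (forall v, v \in J -> r u <= r v) ->
    forall v, v \in J -> r v <= r w.
  move=> uX wX Euw hu v vJ; rewrite leqNgt; apply/negP=> lt.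
  have hu' : forall v, v \in J -> m - r v <= m - r u by move=> t /hu; apply: leq_sub2l.
  have lt' : m - r v < m - r w by apply: ltn_sub2l => //; apply: leq_trans lt (hm v).
  have := below_neighbour_card cD JY uX wX Euw hu' vJ lt' (nb _ vJ).
  by rewrite ltnNge (leq_trans (leq_maxl _ 1) (degJ v vJ)).
(* A vertex level with all of [J] sends only noise to [J], whereas [#|J|] exceeds the minimum degree
   in [J] and so [#|Ms|]. *)
have disj u : u \in X -> (forall v, v \in J -> r v <= r u) ->
    (forall v, v \in J -> r u <= r v) -> False.
  move=> uX h1 h2.
  have : #|J| <= #|Ms|.
    apply: (level_row cXY JY uX) => v vJ; have vY := subsetP JY _ vJ.
    have /card_gt0P[y] := nb v vJ; rewrite inE => /andP[yJ Evy].
    case/or3P: (clash_colour cXY uX vY) => // /eqP e.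
      by have [_ /(_ y Evy)] := clash_R cXY uX vY e; rewrite ltnNge h2.
    by have [_ /(_ y Evy)] := clash_B cXY uX vY e; rewrite ltnNge h1.
  apply/negP; rewrite -ltnNge (cardsD1 z0) z0J add1n ltnS.
  apply: leq_trans (leq_trans (leq_maxl _ 1) (degJ _ z0J)) _.
  apply: subset_leq_card; apply/subsetP=> y; rewrite !inE => /andP[-> Ey].
  by rewrite andbT; apply: contraTneq Ey => ->; rewrite irE.
pose H := [set u in X | [forall v in J, r v <= r u]].
pose W := [set u in X | [forall v in J, r u <= r v]].
have inH u : u \in H -> u \in X /\ forall v, v \in J -> r v <= r u.
  by rewrite inE => /andP[uX /forall_inP].
have inW u : u \in W -> u \in X /\ forall v, v \in J -> r u <= r v.
  by rewrite inE => /andP[uX /forall_inP].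
have HW x y : x \in H -> y \in X -> E x y -> y \in W.
  by move=> /inH[xX hx] yX Exy; rewrite inE yX; apply/forall_inP; apply: low hx.
have WH x y : x \in W -> y \in X -> E x y -> y \in H.
  by move=> /inW[xX hx] yX Exy; rewrite inE yX; apply/forall_inP; apply: high hx.
have HWdis x : x \in H -> x \in W -> False.
  by move=> /inH[xX h1] /inW[_ h2]; apply: (disj x).
have all_ : X \subset H :|: W.
  apply: (conX _ p) => //.
    by rewrite !inE pX; apply/orP; left; apply/forall_inP.
  move=> y z; rewrite in_setU => /orP[yH|yW] _ zX Eyz; rewrite in_setU.
    by rewrite (HW y) ?orbT.
  by rewrite (WH y).
apply: (small_not_bipartite sE (H := H) reg oX outX) => x y xX yX Exy.
have := subsetP all_ _ xX; rewrite in_setU; case: (boolP (x \in H)) => [xH _|xH /= xW].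
  have yW := HW x y xH yX Exy; suff /negbTE-> : y \notin H by [].
  by apply/negP=> yH; apply: (HWdis y).
by rewrite (WH x).
Qed.

(** A vertex of largest [r] in the two sets dominates the core inside the set opposite to it. *)
Lemma clash_cores l R B r X Y J K :
  (forall x, #|[set y | E x y]| = l) ->
  clash R B r X Y -> small_set E l X -> small_set E l Y ->
  J \subset Y -> (exists z, z \in J) ->
  (forall v, v \in J -> maxn #|Ms| 1 <= #|[set y in J | E v y]|) ->
  K \subset X -> (exists z, z \in K) ->
  (forall v, v \in K -> maxn #|Ms| 1 <= #|[set y in K | E v y]|) -> False.
Proof.
move=> reg cXY sX sY JY J0 degJ KX K0 degK.
have [[x0 x0X] _ _ _] := sX; have [[y0 y0Y] _ _ _] := sY.
case: (@arg_maxnP _ x0 [in X] r x0X) => p pX pmax.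
case: (@arg_maxnP _ y0 [in Y] r y0Y) => q qY qmax.
case: (leqP (r q) (r p)) => le.
  apply: (clash_core_high reg cXY sX JY J0 degJ pX) => v /(subsetP JY) vY.
  exact: leq_trans (qmax _ vY) le.
apply: (clash_core_high reg (clash_sym cXY) sY KX K0 degK qY) => v /(subsetP KX) vX.
exact: leq_trans (pmax _ vX) (ltnW le).
Qed.

(* With three noise colours and cubic E the inner degree of the single boundary vertex
   of Y is too small for [clash_cores], but it can only disturb the row of the
   boundary vertex of X. *)
Section ThreeColours.
Hypothesis cM : #|Ms| = 3.

Definition cubic_but X b :=
  [/\ b \in X, #|[set y in X | E b y]| = 2 &
      forall v, v \in X -> v != b -> #|[set y in X | E v y]| = 3].

Lemma cubic_but_pos X b v : cubic_but X b -> v \in X -> 1 < #|[set y in X | E v y]|.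
Proof.
by case=> bX db dX vX; case: (eqVneq v b) => [->|vb]; [rewrite db | rewrite dX].
Qed.

Lemma below_neighbour_boundary R B r X Y b2 p w z :
  clash R B r X Y -> cubic_but Y b2 -> p \in X -> w \in X -> E p w ->
  (forall v, v \in Y -> r v <= r p) -> z \in Y -> r z < r w -> z = b2.
Proof.
move=> cXY dY pX wX Epw hp zY lt; have [_ _ dY3] := dY.
apply/eqP; case: eqVneq => // zb.
have := below_neighbour_card cXY (subxx _) pX wX Epw hp zY lt.
by rewrite (dY3 z) // cM => /(_ isT).
Qed.

Lemma low_of_high_inner R B r X Y b1 b2 p w :
  clash R B r X Y -> cubic_but X b1 -> cubic_but Y b2 ->
  p \in X -> w \in X -> E p w -> w != b1 ->
  (forall v, v \in Y -> r v <= r p) -> forall z, z \in Y -> r w <= r z.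
Proof.
move=> cXY dX dY pX wX Epw wb hp z zY; rewrite leqNgt; apply/negP=> zw.
have only v : v \in Y -> r v < r w -> v = b2.
  exact: below_neighbour_boundary cXY dY pX wX Epw hp.
have ez := only z zY zw; subst z.
have [_ db dY3] := dY; have [_ _ dX3] := dX.
have [kM lab] := below_neighbour_noise cXY (subxx _) pX wX Epw hp zY zw
  (ltnW (cubic_but_pos dY zY)).
set k := c p b2 in kM lab.
have Ewp : E w p by rewrite sE.
have [t [t' [Nt Nt' tt']]] : exists t t',
    [/\ t \in [set y in Y | E b2 y], t' \in [set y in Y | E b2 y] & t != t'].
  have /card_gt1P[t [t' [h1 h2 h3]]] : 1 < #|[set y in Y | E b2 y]| by rewrite db.
  by exists t, t'.
move: Nt Nt'; rewrite !inE => /andP[tY Ebt] /andP[t'Y Ebt'].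
have [ik iM] := setD1P (lab t tY Ebt); have [i'k i'M] := setD1P (lab t' t'Y Ebt').
have ne u v : u \in X -> v \in Y -> u != v by move=> uX vY; apply: (clash_neq cXY uX vY).
have ii' : c w t != c w t'.
  by apply: contraNneq tt' => e; apply/eqP; apply: (Ms_inj (ne w t _ _) (ne w t' _ _) iM).
have three m : m \in Ms -> [|| m == k, m == c w t | m == c w t'].
  move=> mM; apply: contraT; rewrite !negb_or => /and3P[h1 h2 h3].
  have sub : m |: (k |: (c w t |: [set c w t'])) \subset Ms.
    by apply/subsetP=> a; rewrite !inE => /or4P[] /eqP->.
  have := subset_leq_card sub.
  by rewrite cM !cardsU1 cards1 !inE !negb_or h1 h2 h3 ii' ![k == _]eq_sym ik i'k.
(* Noise is impossible on [u b2]: [clash_T] excludes two of the colours, and [p] uses the third at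
   [b2]. R is excluded too, so the colour is B. *)
have key u : u \in X -> E w u -> u != p ->
    (r u < r t) /\ (r u < r t').
  move=> uX Ewu up.
  case/or3P: (clash_colour cXY uX zY) => [/eqP e|/eqP e|uM].
  - have [/(_ w) + _] := clash_R cXY uX zY e; rewrite sE => /(_ Ewu).
    by rewrite ltnNge (ltnW zw).
  - by have [_ h] := clash_B cXY uX zY e; split; apply: h.
  - have Euw : E u w by rewrite sE.
    have := clash_T cXY uX zY (ne w t wX tY) Euw Ebt.
    have := clash_T cXY uX zY (ne w t' wX t'Y) Euw Ebt'.
    case/or3P: (three _ uM) => /eqP e; rewrite e ?eqxx // => _ _.
    case/eqP: up; apply: (Ms_inj (x := b2)); rewrite 1?eq_sym ?ne //.
      by rewrite csym.
    by rewrite csym -/k -e csym.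
(* R would put [s] below [u], and B would put [y] below [w], which only [b2] is. *)
have rows s u : s \in Y -> E b2 s -> u \in X -> E w u -> r u < r s ->
    forall y, y \in Y -> E s y -> y != b2 -> c u y \in Ms /\ c u y != c w s.
  move=> sY Ebs uX Ewu us y yY Esy yb.
  have Euw : E u w by rewrite sE.
  have Eys : E y s by rewrite sE.
  have nl := clash_T cXY uX yY (ne w s wX sY) Euw Eys; split; last by rewrite eq_sym.
  case/or3P: (clash_colour cXY uX yY) => // /eqP e.
    by have [_ /(_ s Eys)] := clash_R cXY uX yY e; rewrite ltnNge (ltnW us).
  have [/(_ w Euw) /(only y yY) ey _] := clash_B cXY uX yY e.
  by rewrite ey eqxx in yb.
have two s : s \in Y -> E b2 s -> 1 < #|[set y in Y | E s y] :\ b2|.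
  move=> sY Ebs; have sb : s != b2 by apply: contraTneq Ebs => ->; rewrite irE.
  by have := cardsD1 b2 [set y in Y | E s y]; rewrite (dY3 s) // !inE zY sE Ebs add1n => -[<-].
(* Two edges from [u] with distinct noise colours other than [c w s]: one of them has colour [k]. *)
have pick s u : s \in Y -> E b2 s -> u \in X -> E w u -> r u < r s ->
    (forall m, m \in Ms -> m != c w s -> m != k -> m = if s == t then c w t' else c w t) ->
    exists y, [/\ y \in Y, E s y, y != b2 & c u y = k].
  move=> sY Ebs uX Ewu us rest.
  have /card_gt1P[y [y' [+ + yy']]] := two s sY Ebs.
  rewrite !inE => /and3P[yb yY Ey] /and3P[y'b y'Y Ey'].
  have [yM yl] := rows s u sY Ebs uX Ewu us y yY Ey yb.
  have [y'M y'l] := rows s u sY Ebs uX Ewu us y' y'Y Ey' y'b.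
  case: (eqVneq (c u y) k) => [e|yk]; first by exists y.
  case: (eqVneq (c u y') k) => [e|y'k]; first by exists y'.
  case/eqP: yy'; apply: (Ms_inj (ne u y uX yY) (ne u y' uX y'Y) yM).
  by rewrite (rest _ yM yl yk) (rest _ y'M y'l y'k).
have rt m : m \in Ms -> m != c w t -> m != k -> m = if t == t then c w t' else c w t.
  move=> mM ml mk; rewrite eqxx; case/or3P: (three _ mM) => /eqP // e;
  by rewrite e eqxx in ml mk.
have rt' m : m \in Ms -> m != c w t' -> m != k -> m = if t' == t then c w t' else c w t.
  move=> mM ml mk; rewrite eq_sym (negbTE tt'); case/or3P: (three _ mM) => /eqP // e;
  by rewrite e eqxx in ml mk.
have common u : u \in X -> E w u -> u != p ->
    exists y, [/\ y \in Y, E t y, E t' y, y != b2 & c u y = k].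
  move=> uX Ewu up; have [ut ut'] := key u uX Ewu up.
  have [y [yY Ey yb yk]] := pick t u tY Ebt uX Ewu ut rt.
  have [y' [y'Y Ey' y'b y'k]] := pick t' u t'Y Ebt' uX Ewu ut' rt'.
  have e : y = y'.
    by apply: (Ms_inj (ne u y uX yY) (ne u y' uX y'Y)); rewrite ?y'k yk.
  by exists y; rewrite {3}e.
have /card_gt1P[u1 [u2 [+ + u12]]] : 1 < #|[set y in X | E w y] :\ p|.
  by have := cardsD1 p [set y in X | E w y]; rewrite (dX3 w) // !inE pX Ewp add1n => -[<-].
rewrite !inE => /and3P[u1p u1X Eu1] /and3P[u2p u2X Eu2].
have [y1 [y1Y Ey1 Ey1' y1b y1k]] := common u1 u1X Eu1 u1p.
have [y2 [y2Y Ey2 Ey2' y2b y2k]] := common u2 u2X Eu2 u2p.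
have [ut ut'] := key u1 u1X Eu1 u1p.
(* Since [y2] is adjacent to both [t] and [t'], the edge [u1 y2] must have colour [k], already used
   at [y2] by [u2]. *)
have [yM yl] := rows t u1 tY Ebt u1X Eu1 ut y2 y2Y Ey2 y2b.
have [_ yl'] := rows t' u1 t'Y Ebt' u1X Eu1 ut' y2 y2Y Ey2' y2b.
have := three _ yM; rewrite (negbTE yl) (negbTE yl') !orbF => /eqP e.
case/eqP: u12; apply: (Ms_inj (x := y2)); rewrite 1?eq_sym ?ne //.
  by rewrite csym.
by rewrite csym y2k csym e.
Qed.

(** The high and low classes now leave out [b1]. Degrees modulo 3 give [b1] equally many neighbours
    in both, and connectedness gives it at least one in each. So [b1] is squeezed to the level of
    [Y] without [b2], which [level] forbids. *)
Lemma clash_cubic_high R B r X Y b1 b2 p :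
  clash R B r X Y -> connected_set E X -> cubic_but X b1 -> cubic_but Y b2 -> 3 < #|Y| ->
  p \in X -> (forall v, v \in Y -> r v <= r p) -> False.
Proof.
move=> cXY conX dX dY Y3 pX hp.
have [m hm] : exists m, forall x, r x <= m.
  by exists (\max_x r x) => x; apply: leq_bigmax.
have cD := clash_dual hm cXY.
have [b1X db1 dX3] := dX; have [b2Y _ _] := dY.
have dual u : (forall v, v \in Y -> r u <= r v) ->
    forall v, v \in Y -> m - r v <= m - r u.
  by move=> hu v /hu; apply: leq_sub2l.
have undual u v : r u < r v -> m - r v < m - r u.
  by move=> lt; apply: ltn_sub2l => //; apply: leq_trans lt (hm v).
pose H := [set u in X :\ b1 | [forall v in Y, r v <= r u]].
pose W := [set u in X :\ b1 | [forall v in Y, r u <= r v]].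
have inH u : u \in H -> [/\ u \in X, u != b1 & forall v, v \in Y -> r v <= r u].
  by rewrite !inE => /andP[/andP[ub uX] /forall_inP].
have inW u : u \in W -> [/\ u \in X, u != b1 & forall v, v \in Y -> r u <= r v].
  by rewrite !inE => /andP[/andP[ub uX] /forall_inP].
have HW0 x y : x \in X -> (forall v, v \in Y -> r v <= r x) ->
    y \in X -> y != b1 -> E x y -> y \in W.
  move=> xX hx yX yb Exy; rewrite !inE yb yX; apply/forall_inP => z.
  exact: (low_of_high_inner cXY dX dY xX yX Exy yb hx).
have HW x y : x \in H -> y \in X -> y != b1 -> E x y -> y \in W.
  by move=> /inH[xX _ hx]; apply: HW0.
have WH x y : x \in W -> y \in X -> y != b1 -> E x y -> y \in H.
  move=> /inW[xX _ hx] yX yb Exy; rewrite !inE yb yX; apply/forall_inP => z zY.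
  have := low_of_high_inner cD dX dY xX yX Exy yb (dual _ hx) zY.
  by rewrite leqNgt [in X in _ -> X]leqNgt; apply: contra; apply: undual.
(* Every vertex of [Y] has a neighbour in [Y] other than [b2], so all edges from [u] to [Y] would be
   noise, but [Y] has more than three vertices. *)
have level u : u \in X -> (forall v, v \in Y -> v != b2 -> r v = r u) -> False.
  move=> uX eu; have : #|Y| <= #|Ms|.
    apply: (level_row cXY (subxx _) uX) => v vY.
    have [y yY /andP[Ey yb]] : exists2 y, y \in Y & E v y && (y != b2).
      have := cubic_but_pos dY vY; rewrite (cardsD1 b2) => h.
      have /card_gt0P[y] : 0 < #|[set y in Y | E v y] :\ b2| by case: (_ \in _) h => /=; case: #|_|.
      by rewrite !inE => /and3P[yb yY Ey]; exists y; rewrite ?Ey.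
    case/or3P: (clash_colour cXY uX vY) => // /eqP e.
      by have [_ /(_ y Ey)] := clash_R cXY uX vY e; rewrite eu // ltnn.
    by have [_ /(_ y Ey)] := clash_B cXY uX vY e; rewrite eu // ltnn.
  by rewrite cM leqNgt Y3.
have disj u : u \in H -> u \in W -> False.
  move=> /inH[uX _ h1] /inW[_ _ h2]; apply: (level u uX) => v vY _.
  by apply/eqP; rewrite eqn_leq h1 ?h2.
have ne0 : exists u, u \in H :|: W.
  case: (eqVneq p b1) => [e|pb]; last first.
    by exists p; rewrite !inE pb pX /=; apply/orP; left; apply/forall_inP.
  have /card_gt0P[w] : 0 < #|[set y in X | E b1 y]| by rewrite db1.
  rewrite inE => /andP[wX Ew]; exists w; rewrite in_setU.
  have wb : w != b1 by apply: contraTneq Ew => ->; rewrite irE.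
  by rewrite (HW0 p w) ?orbT // e.
pose e_ (P : {set T}) := \sum_(x in P) (E x b1 : nat).
have deg (P Q : {set T}) : (forall x y, x \in P -> y \in X -> y != b1 -> E x y -> y \in Q) ->
    Q \subset X :\ b1 -> P \subset X :\ b1 ->
    3 * #|P| = \sum_(x in P) \sum_(y in Q) (E x y : nat) + e_ P.
  move=> PQ QX PX; rewrite mulnC -sum_nat_const /e_ -big_split; apply: eq_bigr => x xP /=.
  have := subsetP PX _ xP; rewrite !inE => /andP[xb xX].
  rewrite -(dX3 x xX xb) (cardsD1 b1) inE b1X /= addnC; congr (_ + _).
  rewrite -sum1_card big_mkcond [RHS]big_mkcond; apply: eq_bigr => y _; rewrite !inE.
  case: (boolP (y \in Q)) => yQ.
    by have := subsetP QX _ yQ; rewrite !inE => /andP[-> ->]; case: (E x y).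
  case: ifP => // /and3P[yb yX Exy]; by rewrite (PQ x y) in yQ.
have subH : H \subset X :\ b1 by apply/subsetP=> u /inH[uX ub _]; rewrite !inE ub.
have subW : W \subset X :\ b1 by apply/subsetP=> u /inW[uX ub _]; rewrite !inE ub.
have eH := deg H W HW subW subH; have eW := deg W H WH subH subW.
have cross : \sum_(x in H) \sum_(y in W) (E x y : nat) =
             \sum_(x in W) \sum_(y in H) (E x y : nat).
  by rewrite exchange_big; apply: eq_bigr => x _; apply: eq_bigr => y _; rewrite sE.
have e2 : e_ H + e_ W <= 2.
  rewrite -db1 /e_ big_mkcond [X in _ + X]big_mkcond -big_split /=.
  rewrite -sum1_card [leqRHS]big_mkcond; apply: leq_sum => y _; rewrite inE sE.
  case: (boolP (y \in H)) => [yH|_]; last first.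
    by case: (boolP (y \in W)) => // /inW[-> _ _]; case: (E b1 y).
  have [-> _ _] := inH y yH.
  by case: (boolP (y \in W)) => [/(disj y yH)|_] //; case: (E b1 y).
have eHW : e_ H = e_ W by rewrite cross in eH; apply: eq_mod3 eH eW e2.
(* Otherwise [H :|: W] is closed under neighbours in [X], hence contains [b1]. *)
have pos : 0 < e_ H.
  rewrite lt0n; apply/negP=> /eqP eH0; have eW0 : e_ W = 0 by rewrite -eHW.
  have nob x : x \in H :|: W -> ~~ E x b1.
    rewrite in_setU => xHW; apply/negP=> Exb; case/orP: xHW => xx.
      by move: eH0; rewrite /e_ (bigD1 x) //= Exb.
    by move: eW0; rewrite /e_ (bigD1 x) //= Exb.
  have [u uHW] := ne0.
  have uX : u \in X by move: uHW; rewrite in_setU => /orP[/inH[]|/inW[]].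
  have : X \subset H :|: W.
    apply: (conX _ u uHW uX) => y z yHW yX zX Eyz.
    have zb : z != b1 by apply: contraTneq Eyz => ->; apply: nob.
    rewrite in_setU; move: yHW; rewrite in_setU => /orP[yH|yW].
      by rewrite (HW y) ?orbT.
    by rewrite (WH y).
  move=> /subsetP /(_ b1 b1X); rewrite in_setU => /orP[/inH[_]|/inW[_]];
  by rewrite eqxx.
have ex (P : {set T}) : 0 < e_ P -> exists2 h, h \in P & E h b1.
  rewrite lt0n => eP; apply/exists_inP; apply: contraNT eP.
  rewrite negb_exists_in => /forall_inP h; rewrite /e_ big1 // => x /h /negbTE->.
  by [].
have [h hH Ehb] := ex H pos; have [l lW Elb] : exists2 h, h \in W & E h b1.
  by apply: ex; rewrite -eHW.
have [hX _ hh] := inH h hH; have [lX _ ll] := inW l lW.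
apply: (level b1 b1X) => v vY vb; case: (ltngtP (r v) (r b1)) => // lt.
  have e := below_neighbour_boundary cXY dY hX b1X Ehb hh vY lt.
  by rewrite e eqxx in vb.
have lt' := undual b1 v lt.
have e := below_neighbour_boundary cD dY lX b1X Elb (dual l ll) vY lt'.
by rewrite e eqxx in vb.
Qed.

Lemma clash_cubic R B r X Y b1 b2 :
  clash R B r X Y -> connected_set E X -> connected_set E Y ->
  cubic_but X b1 -> cubic_but Y b2 -> 3 < #|X| -> 3 < #|Y| -> False.
Proof.
move=> cXY conX conY dX dY X3 Y3.
have [b1X _ _] := dX; have [b2Y _ _] := dY.
case: (@arg_maxnP _ b1 [in X] r b1X) => p pX pmax.
case: (@arg_maxnP _ b2 [in Y] r b2Y) => q qY qmax.
case: (leqP (r q) (r p)) => le.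
  apply: (clash_cubic_high cXY conX dX dY Y3 pX) => v vY.
  exact: leq_trans (qmax _ vY) le.
apply: (clash_cubic_high (clash_sym cXY) conY dY dX X3 qY) => v vX.
exact: leq_trans (pmax _ vX) (ltnW le).
Qed.

End ThreeColours.
End Clash.

(** * Exchanging edges along colour circuits *)

Section Switch.
Variables (T C : finType).
Implicit Types (c : T -> T -> C) (S : {set T}).

Definition cdeg c v m := #|[set w | (w != v) && (c v w == m)]|.

(* Exchange the edges xw and yw for all w in S. *)
Definition switch S x y c : T -> T -> C := fun a b =>
  c (if b \in S then tperm x y a else a) (if a \in S then tperm x y b else b).

Definition balanced S x y c :=
  forall m, #|[set w in S | c x w == m]| = #|[set w in S | c y w == m]|.

Lemma switch_sym S x y c :
  (forall a b, c a b = c b a) -> forall a b, switch S x y c a b = switch S x y c b a.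
Proof. by move=> sc a b; rewrite /switch sc. Qed.

Lemma cdeg_in S c v m : v \notin S ->
  cdeg c v m = #|[set w in S | c v w == m]| +
               #|[set w | [&& w != v, w \notin S & c v w == m]]|.
Proof.
move=> vS; rewrite /cdeg -(cardsID S); congr (_ + _); apply: eq_card => w;
  rewrite !inE; case: (boolP (w \in S)) => wS; rewrite ?andbT ?andbF //=.
by rewrite (memPn vS).
Qed.

(** At a vertex of [S] the switch permutes its edges by a transposition; at [x] and [y] balance
    makes the exchanged edges have the same colour counts. *)
Lemma cdeg_switch S x y c v m :
  (forall a b, c a b = c b a) -> x \notin S -> y \notin S -> balanced S x y c ->
  cdeg (switch S x y c) v m = cdeg c v m.
Proof.
move=> sc xS yS bal; have [vS|vS] := boolP (v \in S).
  have vx : v != x by apply: contraNneq xS => <-.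
  have vy : v != y by apply: contraNneq yS => <-.
  have tv : tperm x y v = v by rewrite tpermD // eq_sym.
  rewrite /cdeg -(card_imset _ (@perm_inj _ (tperm x y))).
  apply: eq_card => w; rewrite inE; apply/imsetP/idP => [[w']|h].
    rewrite inE /switch vS tv if_same => /andP[h1 h2] ->; rewrite h2 andbT.
    by rewrite -{1}tv (inj_eq perm_inj).
  exists (tperm x y w); last by rewrite tpermK.
  by rewrite inE /switch vS tv if_same tpermK -{1}tv (inj_eq perm_inj).
have e1 : #|[set w | [&& w != v, w \notin S & switch S x y c v w == m]]| =
          #|[set w | [&& w != v, w \notin S & c v w == m]]|.
  apply: eq_card => w; rewrite !inE /switch (negbTE vS).
  by case: (boolP (w \in S)).
rewrite !(@cdeg_in S) // e1; congr (_ + _).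
have e2 z : tperm x y v = z ->
    #|[set w in S | switch S x y c v w == m]| = #|[set w in S | c z w == m]|.
  move=> e; apply: eq_card => w; rewrite !inE /switch (negbTE vS).
  by case: (boolP (w \in S)) => //=; rewrite e.
by case: tpermP e2 => [->|->|_ _] /(_ _ (erefl _)) ->; rewrite ?bal.
Qed.

Lemma cdeg_sum c z (P : {set C}) :
  \sum_(m in P) cdeg c z m = #|[set w | (w != z) && (c z w \in P)]|.
Proof.
rewrite -sum1_card (partition_big (c z) [in P]) /=; last by move=> w; rewrite inE => /andP[].
apply: eq_bigr => m mP; rewrite /cdeg -sum1_card; apply: eq_bigl => w; rewrite !inE.
by case: (eqVneq (c z w) m) => [->|] /=; rewrite ?mP ?andbT ?andbF.
Qed.

Lemma cdeg_total c z : \sum_m cdeg c z m = #|T|.-1.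
Proof.
have := cdeg_sum c z setT; rewrite (eq_bigl xpredT); last by move=> m; rewrite inE.
move=> ->; rewrite -cardsT (cardsD1 z setT) inE /=.
by apply: eq_card => w; rewrite !inE andbT.
Qed.

Lemma cdeg_pair c x y (P : {set C}) : x != y -> (forall a b, c a b = c b a) ->
  #|[set w | (w != x) && (c x w \in P)]| =
  (c x y \in P) + #|[set w | [&& w != x, w != y & c x w \in P]]|.
Proof.
move=> xy sc; rewrite (cardsD1 y) !inE eq_sym xy /=; congr (_ + _).
by apply: eq_card => w; rewrite !inE andbCA.
Qed.

Section Circuit.
Variables (c : T -> T -> C) (x y : T).
Hypotheses (sc : forall a b, c a b = c b a) (xy : x != y).

Definition arc m m' :=
  [exists w, [&& w != x, w != y, c x w == m & c y w == m']].

Lemma arc_path p m : path arc m p -> uniq (m :: p) ->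
  exists S : {set T}, [/\ x \notin S, y \notin S,
    forall w, w \in S -> c x w \in belast m p &
    forall k, #|[set w in S | c x w == k]| + (k == last m p) =
              #|[set w in S | c y w == k]| + (k == m)].
Proof.
elim: p m => [|m' p IH] m /=.
  move=> _ _; exists set0; split; rewrite ?inE //; first by move=> w; rewrite inE.
  by move=> k; congr (#|pred_of_set _| + _); apply/setP=> w; rewrite !inE.
move=> /andP[/existsP[w /and4P[wx wy /eqP cx /eqP cy]] pth] /andP[mp up].
have [S [xS yS Sb bal]] := IH m' pth up.
have wS : w \notin S.
  by apply/negP=> /Sb /mem_belast; rewrite cx (negbTE mp).
have cU k z : #|[set v in w |: S | c z v == k]| = (c z w == k) + #|[set v in S | c z v == k]|.
  rewrite (cardsD1 w) !inE eqxx /=; congr (_ + _); apply: eq_card => v; rewrite !inE.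
  by case: (eqVneq v w) => [->|] //=; rewrite (negbTE wS).
exists (w |: S); split.
- by rewrite !inE eq_sym negb_or wx.
- by rewrite !inE eq_sym negb_or wy.
- by move=> v; rewrite !inE => /orP[/eqP->|/Sb h]; rewrite ?cx ?eqxx // h orbT.
- move=> k; rewrite !cU cx cy (eq_sym m) (eq_sym m') -addnA bal.
  by rewrite addnC [_ + (k == m')]addnC.
Qed.

(** The vertex [w0] gives an arc from L to P, so a path from P to L is needed. If there is none, let
    K be the colours reachable from P: colour in K at [x] implies colour in K at [y], and [w0] makes
    the inclusion strict, against the degree comparison. As the path is simple, no other edge of
    colour L at [x] is exchanged. *)
Lemma circuit L P Q w0 :
  (forall m, m != P -> m != Q -> cdeg c x m = cdeg c y m) ->
  cdeg c y P <= cdeg c x P -> P != Q ->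
  P != L -> w0 != x -> w0 != y -> c x w0 = L -> c y w0 = P ->
  exists S : {set T}, [/\ x \notin S, y \notin S, balanced S x y c, w0 \in S &
    forall w, w \in S -> c x w = L -> w = w0].
Proof.
move=> deg leP PQ PL w0x w0y cx0 cy0.
have con : connect arc P L.
  apply: contraT => nPL; pose K := [set m | connect arc P m].
  have PK : P \in K by rewrite inE connect0.
  (* If [Q] is in [K], compare outside [K], where the degrees agree, and use that the total degrees
     are equal. *)
  have le : \sum_(m in K) cdeg c y m <= \sum_(m in K) cdeg c x m.
    case: (boolP (Q \in K)) => QK; last first.
      apply: leq_sum => m mK; case: (eqVneq m P) => [->//|mP].
      by rewrite deg //; apply: contraNneq QK => <-.
    have := cdeg_total c x; rewrite -(cdeg_total c y).
    rewrite (bigID [in K]) [in X in _ = X](bigID [in K]) /=.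
    have -> : \sum_(m | m \notin K) cdeg c x m = \sum_(m | m \notin K) cdeg c y m.
      apply: eq_bigr => m mK; apply: deg; first by apply: contraNneq mK => ->.
      by apply: contraNneq mK => ->.
    by move/addIn->.
  have yx : y != x by rewrite eq_sym.
  move: le; rewrite !cdeg_sum (cdeg_pair _ xy sc) (cdeg_pair _ yx sc) (sc y x).
  rewrite leq_add2l leqNgt => /negP[]; apply: proper_card; apply/properP; split.
    apply/subsetP=> w; rewrite !inE => /and3P[wx wy h]; rewrite wx wy /=.
    apply: connect_trans h (connect1 _); apply/existsP; exists w.
    by rewrite wx wy !eqxx.
  exists w0; first by rewrite !inE w0x w0y cy0 ?PK ?connect0.
  by rewrite !inE w0x w0y cx0 /= ?nPL // inE nPL.
case/connectP: con => p pth; case: (shortenP pth) => q pq uq _ eL.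
have [S [xS yS Sb bal]] := arc_path pq uq.
have Lb : L \notin belast P q.
  by move: uq; rewrite lastI rcons_uniq -eL => /andP[].
have w0S : w0 \notin S by apply/negP=> /Sb; rewrite cx0 (negbTE Lb).
have cU k z : #|[set v in w0 |: S | c z v == k]| = (c z w0 == k) + #|[set v in S | c z v == k]|.
  rewrite (cardsD1 w0) !inE eqxx /=; congr (_ + _); apply: eq_card => v; rewrite !inE.
  by case: (eqVneq v w0) => [->|] //=; rewrite (negbTE w0S).
exists (w0 |: S); split.
- by rewrite !inE eq_sym negb_or w0x.
- by rewrite !inE eq_sym negb_or w0y.
- move=> k; rewrite !cU cx0 cy0 addnC [RHS]addnC (eq_sym L) (eq_sym P) eL.
  exact: bal.
- by rewrite !inE eqxx.
- move=> w; rewrite !inE => /orP[/eqP//|/Sb h] e; by rewrite e (negbTE Lb) in h.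
Qed.

End Circuit.
End Switch.

(** * Colour configurations and the rules at a stuck one *)

Section Configuration.
Variables (T C : finType) (R B L : C) (l : nat) (r : T -> nat).

Definition lgraph (c : T -> T -> C) : rel T := fun v w => (v != w) && (c v w == L).

(** Each noise colour is a perfect matching. The degrees of B follow from the others and decrease as
    [r] grows. *)
Record conf (c : T -> T -> C) : Prop := Conf {
  conf_sym : forall a b, c a b = c b a;
  conf_L : forall v, cdeg c v L = l;
  conf_R : forall v, cdeg c v R = r v;
  conf_M : forall v m, m \notin [:: R; B; L] -> cdeg c v m = 1 }.

Lemma lgraph_sym c : conf c -> symmetric (lgraph c).
Proof. by move=> cc v w; rewrite /lgraph eq_sym (conf_sym cc). Qed.

Lemma lgraph_irr c : irreflexive (lgraph c).
Proof. by move=> v; rewrite /lgraph eqxx. Qed.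

Lemma lgraph_reg c : conf c -> forall v, #|[set w | lgraph c v w]| = l.
Proof.
move=> cc v; rewrite -(conf_L cc v); apply: eq_card => w.
by rewrite !inE /lgraph eq_sym.
Qed.

(* No edge of the matching N is lost by the switch, while it creates the edge w0 y
   between two vertices missed by N. *)
Lemma switch_improves c (S : {set T}) x y w0 N :
  conf c -> x != y -> x \notin S -> y \notin S -> balanced S x y c ->
  w0 \in S -> c x w0 = L -> (forall w, w \in S -> c x w = L -> w = w0) ->
  optimal (lgraph c) N -> N w0 = w0 -> N y = y ->
  conf (switch S x y c) /\ unm (lgraph (switch S x y c)) < unm (lgraph c).
Proof.
move=> cc xy xS yS bal w0S cx0 un /andP[mN leN] Nw0 Ny; have sc := conf_sym cc.
split.
  split; first exact: switch_sym.
  - by move=> v; rewrite cdeg_switch // (conf_L cc).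
  - by move=> v; rewrite cdeg_switch // (conf_R cc).
  - by move=> v m mm; rewrite cdeg_switch // (conf_M cc).
have w0y : w0 != y by apply: contraNneq yS => <-.
have w0x : w0 != x by apply: contraNneq xS => <-.
have [N1 N2] := matchingP _ _ mN.
have keep a b : a != y -> b != w0 -> c a b = L -> b \in S -> tperm x y a = a.
  move=> ay bw ab bS; case: tpermP => [e|e|//]; last by rewrite e eqxx in ay.
  by rewrite e in ab; rewrite (un b bS ab) eqxx in bw.
have sw0y : switch S x y c w0 y = L.
  by rewrite /switch w0S (negbTE yS) tpermR sc.
have mN' : matching (lgraph (switch S x y c)) N.
  apply/matchingP; split=> // a Na; have /andP[_ /eqP cab] := N2 a Na.
  rewrite /lgraph eq_sym Na /= /switch; move: cab; set b := N a => cab.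
  have ay : a != y by apply: contraNneq Na => ->; rewrite Ny.
  have aw : a != w0 by apply: contraNneq Na => ->; rewrite Nw0.
  have by_ : b != y by apply: contraNneq ay => e; rewrite -(N1 a) -/b e Ny.
  have bw : b != w0 by apply: contraNneq aw => e; rewrite -(N1 a) -/b e Nw0.
  have cba : c b a = L by rewrite sc.
  have -> : (if b \in S then tperm x y a else a) = a.
    by case: ifP => // /(keep a b ay bw cab).
  have -> : (if a \in S then tperm x y b else b) = b.
    by case: ifP => // /(keep b a by_ aw cba).
  by rewrite cab.
have mJ : matching (lgraph (switch S x y c)) (join N w0 y).
  apply: join_matching => //; rewrite /lgraph ?(eq_sym y) w0y /= ?sw0y //.
  by rewrite switch_sym // sw0y.
have := unm_le mJ; move: leN; rewrite (missed_join Nw0 Ny w0y) => h1 h2.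
by apply: leq_trans h1; rewrite addn2 ltnS; apply: leq_trans h2 _.
Qed.

Hypotheses (RB : R != B) (RL : R != L) (BL : B != L).

Definition noise : {set C} := [set m | m \notin [:: R; B; L]].

Lemma cdeg_B c v : conf c -> cdeg c v B = #|T|.-1 - l - r v - #|noise|.
Proof.
move=> cc; have := cdeg_total c v.
rewrite (bigD1 B) // (bigD1 R) //= (bigD1 L) /=; last by rewrite eq_sym BL eq_sym RL.
rewrite (conf_L cc) (conf_R cc).
have -> : \sum_(i | (i != B) && (i != R) && (i != L)) cdeg c v i = #|noise|.
  rewrite -sum1_card; apply: eq_big => [m|m mm]; rewrite ?inE.
    by rewrite !negb_or andbCA andbA.
  by apply: (conf_M cc); rewrite !inE !negb_or andbCA andbA.
by move=> <-; lia.
Qed.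

Definition stuck c :=
  conf c /\ forall c', conf c' -> unm (lgraph c) <= unm (lgraph c').

(** If [x w0] has colour L and a maximum matching misses [w0] and [y], a circuit through L would
    turn [w0 y] into an L-edge. [circuit] forbids this only when the colour of [w0 y] has smaller
    degree at [x] than at [y], which yields the rules for R and B. *)
Lemma stuck_clash c (X Y : {set T}) :
  stuck c -> (forall u v, u \in X -> v \in Y ->
    u != v /\ exists N, [/\ optimal (lgraph c) N, N u = u & N v = v]) ->
  clash (lgraph c) c noise R B r X Y.
Proof.
move=> [cc best] miss; have sc := conf_sym cc; have sL := lgraph_sym cc.
have notL u v : u \in X -> v \in Y -> c u v != L.
  move=> uX vY; have [uv [N [oN Nu Nv]]] := miss u v uX vY.
  by have := optimal_nonadj sL oN Nu Nv uv; rewrite /lgraph uv.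
have adj u w : lgraph c u w -> [/\ w != u, c u w = L & c w u = L].
  by move=> /andP[uw /eqP e]; split; rewrite 1?eq_sym // sc.
have degM a b m : m != R -> m != B -> cdeg c a m = cdeg c b m.
  move=> mR mB; case: (eqVneq m L) => [->|mL]; first by rewrite !(conf_L cc).
  by rewrite !(conf_M cc) // !inE !negb_or mR mB.
have rule x y w0 P Q N :
    lgraph c x w0 -> w0 != y -> optimal (lgraph c) N -> N w0 = w0 -> N y = y ->
    c w0 y != L -> (forall m, m != P -> m != Q -> cdeg c x m = cdeg c y m) ->
    cdeg c y P <= cdeg c x P -> P != Q -> P != L -> c w0 y = P -> False.
  move=> /adj[w0x cx0 _] w0y oN Nw Ny nL deg le PQ PL cy0.
  have xy : x != y by apply: contraNneq nL => <-; rewrite sc cx0.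
  have cy0' : c y w0 = P by rewrite sc.
  have [S [xS yS bal w0S un]] := circuit sc xy deg le PQ PL w0x w0y cx0 cy0'.
  have [cc' lt] := switch_improves cc xy xS yS bal w0S cx0 un oN Nw Ny.
  by move: lt; rewrite ltnNge best.
have ruleR x y w0 N : lgraph c x w0 -> w0 != y -> optimal (lgraph c) N ->
    N w0 = w0 -> N y = y -> c w0 y = R -> r x < r y.
  move=> Ex wy oN Nw Ny e; rewrite ltnNge; apply/negP=> le.
  apply: (rule x y w0 R B N) => //; first by rewrite e.
    by move=> m mR mB; apply: degM.
  by rewrite !(conf_R cc).
have ruleB x y w0 N : lgraph c x w0 -> w0 != y -> optimal (lgraph c) N ->
    N w0 = w0 -> N y = y -> c w0 y = B -> r y < r x.
  move=> Ex wy oN Nw Ny e; rewrite ltnNge; apply/negP=> le.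
  apply: (rule x y w0 B R N) => //; first by rewrite e.
  - by move=> m mB mR; apply: degM.
  - by rewrite !cdeg_B // leq_sub2r // leq_sub2l.
  - by rewrite eq_sym.
split.
- by move=> u v uX vY; have [] := miss u v uX vY.
- move=> u v uX vY; rewrite inE !inE; have := notL u v uX vY.
  by case: (c u v == R); case: (c u v == B); case: (c u v == L).
- move=> u v uX vY e; have [uv [N [oN Nu Nv]]] := miss u v uX vY.
  split=> [w|z] E; first by apply: ruleR oN Nu Nv e; rewrite // sL.
  by apply: ruleR oN Nv Nu _; rewrite // 1?sL // 1?eq_sym // sc.
- move=> u v uX vY e; have [uv [N [oN Nu Nv]]] := miss u v uX vY.
  split=> [w|z] E; first by apply: ruleB oN Nu Nv e; rewrite // sL.
  by apply: ruleB oN Nv Nu _; rewrite // 1?sL // 1?eq_sym // sc.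
move=> u v w z uX vY wz Euw Evz; have [uv [N [oN Nu Nv]]] := miss u v uX vY.
have [wu cuw cwu] := adj _ _ Euw; have [zv cvz czv] := adj _ _ Evz.
apply/eqP=> e; have nL := notL u v uX vY.
have wz_ : w != v by apply: contraNneq nL => <-; rewrite cuw.
have uz : u != z by apply: contraNneq nL => ->; rewrite czv.
(* For [clash_T] the circuit has length two, between L and the common colour of [u v] and [w z]. *)
have xS : w \notin [set u; z].
  by rewrite !inE negb_or wu.
have yS : v \notin [set u; z] by rewrite !inE negb_or eq_sym uv eq_sym zv.
have bal : balanced [set u; z] w v c.
  move=> m; have cU a : #|[set t in [set u; z] | c a t == m]| = (c a u == m) + (c a z == m).
    rewrite (cardsD1 u) (cardsD1 z) !inE !eqxx orbT (eq_sym z) uz /= addnA -[RHS]addn0.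
    congr (_ + _); apply: eq_card0 => t; rewrite !inE.
    by case: (eqVneq t z) => //= _; case: (eqVneq t u).
  by rewrite !cU cwu cvz e (sc v u) addnC.
have un t : t \in [set u; z] -> c w t = L -> t = u.
  by rewrite !inE => /orP[/eqP//|/eqP->]; rewrite e => /eqP; rewrite (negbTE nL).
have uS : u \in [set u; z] by rewrite !inE eqxx.
have [cc' lt] := switch_improves cc wz_ xS yS bal uS cwu un oN Nu Nv.
by move: lt; rewrite ltnNge best.
Qed.

End Configuration.

(** * Inner degrees in small sets *)

Section SmallSetCores.
Variables (T : finType) (E : rel T) (l : nat) (X : {set T}).
Hypotheses (sE : symmetric E) (irE : irreflexive E).
Hypotheses (reg : forall x, #|[set y | E x y]| = l) (sX : small_set E l X).

Lemma small_card : l < #|X|.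
Proof.
have [[x xX] _ out _] := sX; apply: (card_lt_small irE reg _ out).
by apply/card_gt0P; exists x.
Qed.

Lemma small_outdeg_parity : odd (outdeg E X) = odd l.
Proof.
have [_ oX _ _] := sX; have := congr1 odd (eI_outdeg X reg).
by rewrite oddD (negbTE (eI_even sE irE X)) oddM oX andbT.
Qed.

(** Otherwise the inner degrees sum to at most 2(t - 1)#|X| <= (l - 1)#|X|, leaving at least #|X| >
    l outgoing edges. *)
Lemma small_has_core t : 0 < t -> 2 * t <= l + 1 ->
  exists J : {set T}, [/\ J \subset X, exists z, z \in J &
    forall v, v \in J -> t <= #|[set y in J | E v y]|].
Proof.
move=> t0 tl.
pose Q (J : {set T}) := [&& J \subset X, J != set0 & [forall v in J, t <= #|[set y in J | E v y]|]].
have [/existsP[J /and3P[JX /set0Pn J0 /forall_inP h]]|no] := boolP [exists J, Q J].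
  by exists J.
have le : eI E X <= 2 * t.-1 * #|X|.
  apply: (core sE irE) => J JX [x xJ].
  have : ~~ Q J by move: no; rewrite negb_exists => /forallP.
  rewrite /Q JX /= negb_and negbK => /orP[/eqP J0|]; first by rewrite J0 inE in xJ.
  rewrite negb_forall_in => /exists_inP[v vJ]; rewrite -ltnNge => lt.
  by exists v => //; rewrite -ltnS prednK.
have := eI_outdeg X reg; have := small_card; have [_ _ + _] := sX.
move: le; move: (eI E X) (outdeg E X) #|X| => a b n; nia.
Qed.

Lemma small_degree v : v \in X ->
  #|[set y in X | E v y]| + #|[set y | E v y] :\: X| = l.
Proof.
move=> vX; rewrite -(reg v) -(cardsID X [set y | E v y]); congr (_ + _).
by apply: eq_card => y; rewrite !inE andbC.
Qed.

Lemma small_quadratic v : l = 2 -> v \in X -> #|[set y in X | E v y]| = 2.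
Proof.
move=> l2 vX; have [_ _ out _] := sX; have := small_outdeg_parity.
have : outdeg E X <= 1 by rewrite -ltnS -l2.
case e : (outdeg E X) => [|[|]] //; last by rewrite l2.
move/eqP: e; rewrite sum_nat_eq0 => /forall_inP /(_ v vX) /eqP e _ _.
by have := small_degree vX; rewrite e l2 addn0.
Qed.

(** The number of outgoing edges is odd and below 3, so it is 1; [b] is the end of that edge in
    [X]. *)
Lemma small_cubic : l = 3 -> exists b, cubic_but E X b.
Proof.
move=> l3; have [_ _ out _] := sX; have := small_outdeg_parity.
have : outdeg E X <= 2 by rewrite -ltnS -l3.
case e : (outdeg E X) => [|[|[|]]] //; rewrite l3 // => _ _.
have [b bX pos] : exists2 b, b \in X & 0 < #|[set y | E b y] :\: X|.
  apply/exists_inP; apply: contraT; rewrite negb_exists_in => /forall_inP h.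
  suff : outdeg E X = 0 by rewrite e.
  by apply/eqP; rewrite sum_nat_eq0; apply/forall_inP=> z /h; rewrite -eqn0Ngt.
move: e; rewrite /outdeg (bigD1 b) //= => e.
have [eb e0] : #|[set y | E b y] :\: X| = 1 /\
    \sum_(i in X | i != b) #|[set y | E i y] :\: X| = 0.
  by move: pos e; move: #|_| (\sum_(i in X | _) _) => [|[|a]] // [|c].
exists b; split=> //.
  by have := small_degree bX; rewrite eb l3 addn1 => -[].
move=> v vX vb; have := small_degree vX; rewrite l3.
move/eqP: e0; rewrite sum_nat_eq0 => /forallP /(_ v); rewrite vX vb => /eqP ->.
by rewrite addn0.
Qed.

End SmallSetCores.

(** When a further perfect matching can be extracted from an L-graph of degree [l] beside [s] found
    ones. The cases are settled by parity, by cores of minimum degree [maxn s 1], by 2-regular small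
    sets serving as their own cores, and by the cubic argument. *)
Definition admissible s l :=
  [|| l == 1, 2 * s <= l + 1, (s == 2) && (l == 2) | (s == 3) && (l == 3)].

(** * Extracting perfect matchings one at a time *)

Section Steps.
Variable T : finType.
Hypothesis evT : ~~ odd #|T|.

Lemma stuck_perfect (C : finType) (R B L : C) l r (c : T -> T -> C) :
  R != B -> R != L -> B != L -> stuck R B L l r c -> 0 < l ->
  admissible #|noise R B L| l -> unm (lgraph L c) = 0.
Proof.
move=> RB RL BL st l0 adm; apply/eqP; rewrite eqn0Ngt; apply/negP=> pos.
have [cc _] := st; have sL := lgraph_sym cc; have irL := @lgraph_irr T C L c.
have reg := lgraph_reg cc.
have [X [Y [sX sY miss]]] := two_small_components sL reg l0 evT pos.
have cl := stuck_clash RB RL BL st miss.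
have inj x y z : x != y -> x != z -> c x y \in noise R B L -> c x z = c x y -> y = z.
  move=> xy xz; rewrite inE => /(conf_M cc x) /eqP/cards1P[t e] exz.
  have : y \in [set w | (w != x) && (c x w == c x y)] by rewrite inE eq_sym xy eqxx.
  have : z \in [set w | (w != x) && (c x w == c x y)] by rewrite inE eq_sym xz exz eqxx.
  by rewrite e !inE => /eqP-> /eqP->.
case/or4P: adm => [/eqP l1|le|/andP[/eqP s2 /eqP l2]|/andP[/eqP s3 /eqP l3]].
- have := small_outdeg_parity sL irL reg sX; have [_ _ out _] := sX.
  by move: out; rewrite l1 ltnS leqn0 => /eqP->.
- have t0 : 0 < maxn #|noise R B L| 1 by rewrite leq_max orbT.
  have tl : 2 * maxn #|noise R B L| 1 <= l + 1.
    by rewrite maxnMr geq_max le addn1 ltnS l0.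
  have [J [JX J0 degJ]] := small_has_core sL irL reg sX t0 tl.
  have [K [KY K0 degK]] := small_has_core sL irL reg sY t0 tl.
  exact: (clash_cores sL irL (conf_sym cc) inj reg cl sX sY KY K0 degK JX J0 degJ).
- have [[x0 x0X] _ _ _] := sX; have [[y0 y0Y] _ _ _] := sY.
  have m2 : maxn #|noise R B L| 1 = 2 by rewrite s2.
  have dX v : v \in X -> maxn #|noise R B L| 1 <= #|[set y in X | lgraph L c v y]|.
    by move=> vX; rewrite m2 (small_quadratic sL irL reg sX l2 vX).
  have dY v : v \in Y -> maxn #|noise R B L| 1 <= #|[set y in Y | lgraph L c v y]|.
    by move=> vY; rewrite m2 (small_quadratic sL irL reg sY l2 vY).
  apply: (clash_cores sL irL (conf_sym cc) inj reg cl sX sY (subxx _) _ dY (subxx _) _ dX).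
    by exists y0.
  by exists x0.
- have [b1 dX] := small_cubic sL irL reg sX l3.
  have [b2 dY] := small_cubic sL irL reg sY l3.
  have cX := small_card irL reg sX; have cY := small_card irL reg sY.
  rewrite l3 in cX cY; have [_ _ _ conX] := sX; have [_ _ _ conY] := sY.
  exact: (clash_cubic sL irL (conf_sym cc) inj s3 cl conX conY dX dY cX cY).
Qed.

Lemma exists_stuck (C : finType) (R B L : C) l r (c : T -> T -> C) :
  conf R B L l r c -> exists c' : T -> T -> C, stuck R B L l r c'.
Proof.
elim/ltn_ind: {c}(unm (lgraph L c)) {-2}c (erefl (unm (lgraph L c))) => m IH c em cc.
case: (classic (exists2 c', conf R B L l r c' & unm (lgraph L c') < m)) => [[c' cc' lt]|no].
  exact: (IH _ lt c').
exists c; split=> // c' cc'; rewrite em leqNgt; apply/negP=> lt.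
by apply: no; exists c'.
Qed.

(** The colour type is quantified because each extraction adds a colour. *)
Definition packed s l (r : T -> nat) :=
  exists (C : finType) (R B L : C) (c : T -> T -> C),
    [/\ R != B, R != L, B != L, conf R B L l r c & #|noise R B L| = s].

(** At a stuck configuration L has a perfect matching, which receives the new colour [None]. *)
Lemma packed_step s l r : packed s l.+1 r -> admissible s l.+1 -> packed s.+1 l r.
Proof.
move=> [C [R [B [L [c0 [RB RL BL cc0 cs]]]]]] adm.
have [c st] := exists_stuck cc0; have [cc _] := st.
rewrite -cs in adm; have u0 := stuck_perfect RB RL BL st isT adm.
have [N /andP[/matchingP[N1 N2] leN]] := exists_optimal (lgraph L c).
have NN v : N v != v.
  move: leN; rewrite u0 leqn0 cards_eq0 => /eqP e.
  by apply: contraT; rewrite negbK => Nv; have := in_set0 v; rewrite -e inE Nv.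
have cN v : c v (N v) = L by have /andP[_ /eqP] := N2 v (NN v).
pose c' v w := if N v == w then None else Some (c v w).
have deg v m : m != L -> cdeg c' v (Some m) = cdeg c v m.
  move=> mL; apply: eq_card => w; rewrite !inE /c'; case: (eqVneq (N v) w) => [<-|//].
  by rewrite cN [L == m]eq_sym (negbTE mL).
exists (option C), (Some R), (Some B), (Some L), c'; split=> //.
- split.
  + move=> a b; rewrite /c' (conf_sym cc a b); congr (if _ then _ else _).
    by apply/eqP/eqP => <-.
  + move=> v; have := conf_L cc v; rewrite /cdeg (cardsD1 (N v)) inE NN cN eqxx => -[<-].
    apply: eq_card => w; rewrite !inE /c' (eq_sym w (N v)).
    by case: (eqVneq (N v) w) => [_|_] //=; rewrite andbF.
  + by move=> v; rewrite deg // (conf_R cc).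
  + move=> v [m|].
      rewrite !inE => h; rewrite deg ?(conf_M cc) //; first by rewrite !inE.
      by apply: contra h => /eqP->; rewrite eqxx !orbT.
    move=> _; apply/eqP/cards1P; exists (N v); apply/setP=> w; rewrite !inE /c' (eq_sym w (N v)).
    by case: (eqVneq (N v) w) => [<-|_] //=; rewrite ?NN ?andbF.
- rewrite -cs; have -> : noise (Some R) (Some B) (Some L) = None |: Some @: noise R B L.
    apply/setP=> -[m|]; rewrite !inE //=.
    by rewrite mem_imset ?inE //; apply: Some_inj.
  rewrite cardsU1 card_imset; last exact: Some_inj.
  suff -> : None \notin Some @: noise R B L by [].
  by apply/imsetP=> -[].
Qed.

Lemma packed_steps s l r : packed 0 (s + l) r ->
  (forall i, i < s -> admissible i (s + l - i)) -> packed s l r.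
Proof.
move=> p0 adm.
have : forall i, i <= s -> packed i (s + l - i) r.
  elim=> [|i IH] lt; first by rewrite subn0.
  have e : s + l - i = (s + l - i.+1).+1 by lia.
  by apply: packed_step; rewrite -e; [apply: IH; apply: ltnW | apply: adm].
by move/(_ s (leqnn s)); rewrite addKn.
Qed.

Lemma packed0 K r (P G : rel T) :
  symmetric P -> symmetric G -> (forall v w, v != w -> P v w -> G v w) ->
  (forall v, cdeg P v true = r v) -> (forall v, cdeg G v true = r v + K) ->
  packed 0 K r.
Proof.
move=> sP sG sub dP dG.
(* Colour 0 is R, the edges of [P]; 2 is L, the other edges of [G]; 1 is B, the remaining pairs. *)
pose c v w : 'I_3 := if P v w then inord 0 else if G v w then inord 2 else inord 1.
have n01 : (inord 0 : 'I_3) != inord 1 by rewrite -val_eqE /= !inordK.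
have n02 : (inord 0 : 'I_3) != inord 2 by rewrite -val_eqE /= !inordK.
have n12 : (inord 1 : 'I_3) != inord 2 by rewrite -val_eqE /= !inordK.
have [n10 n20] : (inord 1 : 'I_3) != inord 0 /\ (inord 2 : 'I_3) != inord 0.
  by rewrite eq_sym n01 eq_sym n02.
have all3 (m : 'I_3) : m \in [:: inord 0; inord 1; inord 2].
  by rewrite !inE -!val_eqE /= !inordK //; case: m => [[|[|[|]]]].
have cP v : cdeg c v (inord 0) = r v.
  rewrite -dP; apply: eq_card => w; rewrite !inE /c; case: (P v w); rewrite ?eqxx //.
  by case: (G v w); rewrite ?(negbTE n20) ?(negbTE n10).
exists 'I_3, (inord 0), (inord 1), (inord 2), c; split=> //.
  split=> //.
  - by move=> a b; rewrite /c sP sG.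
  - move=> v; have := dG v; rewrite -(cP v).
    have -> : cdeg G v true = cdeg c v (inord 0) + cdeg c v (inord 2).
      rewrite /cdeg -(cardsID [set w | P v w] [set w | (w != v) && (G v w == true)]).
      congr (_ + _); apply: eq_card => w; rewrite !inE /c.
        case: (boolP (P v w)) => [Pvw|_] /=; rewrite ?andbF ?eqxx ?andbT.
          by case: (eqVneq w v) => //= wv; rewrite (sub v w) // eq_sym.
        by case: (G v w); rewrite ?(negbTE n20) ?(negbTE n10) andbF.
      case: (boolP (P v w)) => [Pvw|_] /=; first by rewrite (negbTE n02) andbF.
      by case: (G v w); rewrite ?eqxx ?(negbTE n12).
    by move/addnI.
  - by move=> v m; rewrite all3.
by apply/eqP; rewrite cards_eq0; apply/eqP/setP=> m; rewrite !inE; have := all3 m; rewrite !inE => ->.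
Qed.

End Steps.

(** * Kundu's theorem *)

Section Kundu.
Variable T : finType.
Implicit Types (P G : rel T).

Definition excess P G := [set e : T * T | [&& e.1 != e.2, P e.1 e.2 & ~~ G e.1 e.2]].

(** Replacing the edges [x z], [y w] of [G] by [x y], [z w] repairs [x y]. It can damage only [y w],
    and only if this edge is in [P]; then [z w] is in [P] and is repaired too. *)
Lemma kundu_switch P G x y z w :
  symmetric P -> symmetric G -> y != z -> x != y -> x != z -> w != y -> w != z -> w != x ->
  P x y -> ~~ G x y -> ~~ P x z -> G x z ->
  G y w -> ~~ G z w -> ~~ P y w || P z w ->
  exists G', [/\ symmetric G', forall v m, cdeg G' v m = cdeg G v m &
    #|excess P G'| < #|excess P G|].
Proof.
move=> sP sG yz xy xz wy wz wx Pxy Gxy Pxz Gxz Gyw Gzw bad.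
pose S := [set x; w].
have yS : y \notin S by rewrite !inE negb_or eq_sym xy eq_sym wy.
have zS : z \notin S by rewrite !inE negb_or eq_sym xz eq_sym wz.
have wS : w \in S by rewrite !inE eqxx orbT.
have xS : x \in S by rewrite !inE eqxx.
have bal : balanced S y z G.
  move=> m; have cU a : #|[set t in S | G a t == m]| = (G a x == m) + (G a w == m).
    rewrite (cardsD1 x) (cardsD1 w) !inE !eqxx orbT wx /= addnA -[RHS]addn0.
    congr (_ + _); apply: eq_card0 => t; rewrite !inE.
    by case: (eqVneq t x) => [|_] /=; rewrite ?andbF //; case: (eqVneq t w).
  rewrite !cU !(sG _ x) (negbTE Gxy) Gxz Gyw (negbTE Gzw) addnC.
  by [].
exists (switch S y z G); split.
- by apply: switch_sym.
- by move=> v m; apply: cdeg_switch.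
have out a b : a \notin S -> b \notin S -> switch S y z G a b = G a b.
  by move=> aS bS; rewrite /switch (negbTE aS) (negbTE bS).
have ins a b : a \in S -> b \notin S -> switch S y z G a b = G a (tperm y z b).
  by move=> aS bS; rewrite /switch aS (negbTE bS).
have inn a b : a \in S -> b \in S -> switch S y z G a b = G a b.
  move=> aS bS; rewrite /switch aS bS !tpermD //;
  by [apply: contraNneq yS => -> | apply: contraNneq zS => ->].
have Gwz : G w z = false by rewrite sG (negbTE Gzw).
pose cross (e : T * T) :=
  (e.1 \in S) && (e.2 \in [:: y; z]) || (e.2 \in S) && (e.1 \in [:: y; z]).
have nyS b : b \in [:: y; z] -> b \notin S by rewrite !inE => /orP[] /eqP->; rewrite -in_set2.
have ncross a b : ~~ cross (a, b) -> switch S y z G a b = G a b.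
  rewrite negb_or !negb_and /=; case: (boolP (a \in S)) => aS; case: (boolP (b \in S)) => bS.
  - by rewrite inn.
  - rewrite /= andbT !inE negb_or => /andP[by_ bz]; rewrite ins // tpermD // eq_sym //.
  - rewrite /= !inE negb_or => /andP[ay az].
    by rewrite switch_sym // ins // tpermD 1?eq_sym // sG.
  - by rewrite out.
have half a b : a \in S -> b \in [:: y; z] -> P a b -> ~~ switch S y z G a b ->
    a = w /\ b = y.
  move=> aS byz; rewrite ins ?nyS //; move: aS byz; rewrite !inE.
  case/orP=> /eqP-> /orP[] /eqP->; rewrite ?tpermL ?tpermR.
  - by rewrite Gxz.
  - by rewrite (negbTE Pxz).
  - by [].
  - by rewrite sG Gyw.
have sub1 : excess P (switch S y z G) :\: [set e | cross e] =
            excess P G :\: [set e | cross e].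
  apply/setP=> -[a b]; rewrite !inE; case: (boolP (cross (a, b))) => //= nc.
  by rewrite ncross.
have sub2 : excess P (switch S y z G) :&: [set e | cross e] \subset
    (if P y w then [set (y, w); (w, y)] else set0).
  apply/subsetP=> -[a b]; rewrite !inE /= => /andP[/and3P[_ Pab Gab]].
  case/orP=> /andP[h1 h2].
    have [ea eb] := half a b h1 h2 Pab Gab; subst a b.
    by rewrite sP in Pab; rewrite Pab !inE eqxx orbT.
  have Pba : P b a by rewrite sP.
  have Gba : ~~ switch S y z G b a by rewrite switch_sym.
  have [eb ea] := half b a h1 h2 Pba Gba.
  by subst a b; rewrite Pab !inE eqxx.
(* [excess] counts ordered pairs: at most two appear when [P y w] holds, so three of those that
   disappear suffice. *)
have sub3 : (if P y w then [set (x, y); (y, x); (z, w)] else [set (x, y)]) \subset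
    excess P G :&: [set e | cross e].
  have yx : y != x by rewrite eq_sym.
  have zw : z != w by rewrite eq_sym.
  have in1 : (x, y) \in excess P G :&: [set e | cross e].
    by rewrite !inE /= xy Pxy Gxy /cross /= !inE !eqxx.
  case: ifP => Pyw; last by rewrite sub1set.
  apply/subsetP=> e; rewrite !inE -orbA => /or3P[] /eqP->; first by rewrite !inE in in1.
    by rewrite /= /cross /= yx sP Pxy sG Gxy !inE !eqxx orbT.
  by rewrite Pyw /= in bad; rewrite /= /cross /= zw bad Gzw !inE !eqxx !orbT.
rewrite -(cardsID [set e | cross e]) -[X in _ < X](cardsID [set e | cross e]) sub1.
rewrite ltn_add2r; apply: leq_ltn_trans (subset_leq_card sub2) _.
apply: leq_trans (subset_leq_card sub3); case: ifP => _; last by rewrite cards0 cards1.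
have -> : #|[set (x, y); (y, x); (z, w)]| = 3.
  by rewrite -setUA !cardsU1 cards1 !inE !xpair_eqE (negbTE xy) (negbTE xz) (negbTE yz).
by rewrite cards2; case: (_ != _).
Qed.

(** Induction on the pairs in [P] outside [G]: a switch of [G], or of [P] after passing to
    complements, lowers their number and keeps all degrees. *)
Lemma kundu K P G : symmetric P -> symmetric G ->
  (forall v, cdeg G v true = cdeg P v true + K) ->
  exists P' G', [/\ symmetric P', symmetric G',
    forall v, cdeg P' v true = cdeg P v true, forall v, cdeg G' v true = cdeg G v true &
    forall v w, v != w -> P' v w -> G' v w].
Proof.
elim/ltn_ind: {P G}#|excess P G| {-2}P {-2}G (erefl #|excess P G|) => m IH P G em sP sG deg.
have [|[[x y]]] := set_0Vmem (excess P G).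
  move=> e0; exists P, G; split=> // v w vw Pvw; apply: contraT => nG.
  by have := in_set0 (v, w); rewrite -e0 inE /= vw Pvw nG.
rewrite inE /= => /and3P[xy Pxy Gxy].
have [z [zx Gxz Pxz]] : exists z, [/\ z != x, G x z & ~~ P x z].
  have [z] : exists z, (z \in [set w | (w != x) && (G x w == true)]) &&
      (z \notin [set w | (w != x) && (P x w == true)]).
    apply/existsP; apply: contraT; rewrite negb_exists => /forallP h.
    have : cdeg G x true < cdeg P x true.
      apply: proper_card; apply/properP; split.
        by apply/subsetP=> z zz; have := h z; rewrite zz /= negbK.
      by exists y; rewrite inE ?(negbTE Gxy) ?andbF // eq_sym xy Pxy.
    by rewrite deg ltnNge leq_addr.
  rewrite !inE => /andP[/andP[zx /eqP Gxz]]; rewrite zx /= => Pxz; exists z; split=> //.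
  by move: Pxz; case: (P x z).
have yz : y != z by apply: contraNneq Gxy => ->.
(* The degrees of [G] at [y] and [P] at [z] have the same sum as those of [G] at [z] and [P] at [y].
   The edge [y z] cancels, and [x] contributes 0 against 2, so another vertex must compensate. *)
have [w [wy wz lt]] : exists w, [/\ w != y, w != z &
    (G z w : nat) + (P y w : nat) < (G y w : nat) + (P z w : nat)].
  have [w] : exists w, [&& w != y, w != z &
    (G z w : nat) + (P y w : nat) < (G y w : nat) + (P z w : nat)]; last first.
    by case/and3P=> h1 h2 h3; exists w.
  apply/existsP; apply: contraT; rewrite negb_exists => /forallP h.
  have split2 (Q : rel T) a b : symmetric Q -> a != b ->
      cdeg Q a true = (Q a b : nat) + \sum_(w | (w != a) && (w != b)) (Q a w : nat).
    move=> sQ ab; rewrite /cdeg -sum1_card big_mkcond /=.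
    rewrite (bigD1 b) //= !inE eq_sym ab /=; congr (_ + _); first by case: (Q a b).
    rewrite [RHS]big_mkcond [LHS]big_mkcond; apply: eq_bigr => w _; rewrite inE.
    by case: (w != a); case: (w != b); case: (Q a w).
  have zy : z != y by rewrite eq_sym.
  have lt : \sum_(w | (w != y) && (w != z)) ((G y w : nat) + (P z w : nat)) <
            \sum_(w | (w != y) && (w != z)) ((G z w : nat) + (P y w : nat)).
    rewrite (bigD1 x) ?xy 1?eq_sym //= [X in _ < X](bigD1 x) ?xy 1?eq_sym //=.
    rewrite !(sG _ x) !(sP _ x) (negbTE Gxy) (negbTE Pxz) Gxz Pxy addSn ltnS.
    apply: leq_trans (leq_addl _ _); rewrite add0n.
    apply: leq_sum => w /andP[/andP[wy wz] _]; rewrite leqNgt.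
    by have := h w; rewrite wy wz.
  have := deg y; have := deg z.
  rewrite (split2 G y z) // (split2 P y z) // (split2 G z y) // (split2 P z y) //.
  rewrite (sG z y) (sP z y) !(eq_bigl _ _ (fun w => andbC (w != z) (w != y))).
  move: lt; rewrite !big_split /=.
  by move: (\sum_(w | _) _) (\sum_(w | _) _) (\sum_(w | _) _) (\sum_(w | _) _) => a b c d; lia.
have wx : w != x.
  by apply: contraTneq lt => ->; rewrite !(sG _ x) !(sP _ x) (negbTE Gxy) Gxz Pxy -leqNgt; case: (P x z).
have xz : x != z by rewrite eq_sym.
case: (boolP [&& G y w, ~~ G z w & ~~ P y w || P z w]) => [/and3P[Gyw Gzw bad]|nb].
  have [G' [sG' dG' lt']] :=
    kundu_switch sP sG yz xy xz wy wz wx Pxy Gxy Pxz Gxz Gyw Gzw bad.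
  rewrite em in lt'; have [|P2 [G2 [h1 h2 h3 h4 h5]]] := IH _ lt' P G' (erefl _) sP sG'.
    by move=> v; rewrite dG' deg.
  by exists P2, G2; split=> // v; rewrite h4 dG'.
have sN (Q : rel T) : symmetric Q -> symmetric (fun a b => ~~ Q a b).
  by move=> sQ a b; rewrite sQ.
(* In the remaining cases the complements of [G] and [P] satisfy the hypotheses in the roles of [P]
   and [G]. *)
have [Q [sQ dQ]] : exists G', [/\ symmetric G', forall v m, cdeg G' v m = cdeg (fun a b => ~~ P a b) v m &
    #|excess (fun a b => ~~ G a b) G'| < #|excess (fun a b => ~~ G a b) (fun a b => ~~ P a b)|].
  apply: (@kundu_switch _ _ x y z w); rewrite ?negbK //; try exact: sN.
  1-3: by move: lt nb; case: (G y w); case: (G z w); case: (P y w); case: (P z w).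
have exN (Q1 Q2 : rel T) : excess (fun a b => ~~ Q1 a b) (fun a b => ~~ Q2 a b) = excess Q2 Q1.
  by apply/setP=> e; rewrite !inE negbK; congr (_ && _); apply: andbC.
have -> : excess (fun a b => ~~ G a b) Q = excess (fun a b => ~~ Q a b) G.
  by apply/setP=> e; rewrite !inE; congr (_ && _); apply: andbC.
rewrite exN em => lt'.
have dN (Q1 : rel T) v i : cdeg (fun a b => ~~ Q1 a b) v i = cdeg Q1 v (~~ i).
  by apply: eq_card => u; rewrite !inE; case: (Q1 v u); case: i.
have dQ' v : cdeg (fun a b => ~~ Q a b) v true = cdeg P v true by rewrite dN dQ dN.
have [|P2 [G2 [h1 h2 h3 h4 h5]]] := IH _ lt' _ G (erefl _) (sN _ sQ) sG.
  by move=> v; rewrite dQ' deg.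
by exists P2, G2; split=> // v; rewrite h3 dQ'.
Qed.

End Kundu.

(** * Petersen's 2-factor theorem *)

Section Orientation.
Variable T : finType.
Implicit Types (s t : seq (T * T)) (e : T * T).

(** A list of pairs serves both as a multigraph and as an orientation of it; [between] forgets the
    direction. *)
Definition between t x y := count_mem (x, y) t + count_mem (y, x) t.
Definition outs t x := count (fun e => e.1 == x) t.
Definition ins t x := count (fun e => e.2 == x) t.

Lemma between_rem t e x y : e \in t ->
  between t x y = (e == (x, y)) + (e == (y, x)) + between (rem e t) x y.
Proof.
move=> /perm_to_rem /seq.permP h; rewrite /between !h /=.
by rewrite -!addnA; congr (_ + _); rewrite addnCA.
Qed.

Lemma outs_rem t e x : e \in t -> outs t x = (e.1 == x) + outs (rem e t) x.
Proof. by move=> /perm_to_rem /seq.permP h; rewrite /outs h. Qed.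

Lemma ins_rem t e x : e \in t -> ins t x = (e.2 == x) + ins (rem e t) x.
Proof. by move=> /perm_to_rem /seq.permP h; rewrite /ins h. Qed.

Lemma between_cons t e x y :
  between (e :: t) x y = (e == (x, y)) + (e == (y, x)) + between t x y.
Proof. by rewrite /between /= -!addnA; congr (_ + _); rewrite addnCA. Qed.

Lemma pair_flip (a b x y : T) :
  ((a, b) == (x, y)) + ((a, b) == (y, x)) = ((b, a) == (x, y)) + ((b, a) == (y, x)) :> nat.
Proof. by rewrite !xpair_eqE addnC andbC [in X in _ + X]andbC. Qed.

(* Splitting off: two edges ab, bc are replaced by the single edge ac, and an
   orientation of the shorter list is lifted back. *)
Lemma balanced_orientation s :
  (forall x, ~~ odd (outs s x + ins s x)) ->
  exists t, (forall x y, between t x y = between s x y) /\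
            forall x, outs t x = ins t x.
Proof.
elim/ltn_ind: {s}(size s) {-2}s (erefl (size s)) => m IH [|[a b] s] es even.
  by exists [::].
have dcons x : outs ((a, b) :: s) x + ins ((a, b) :: s) x =
    (a == x) + (b == x) + (outs s x + ins s x).
  by rewrite /outs /ins /= addnACA.
have lt : size s < m by rewrite -es.
have [ab|ab] := eqVneq a b.
  subst b; have [x|t [h1 h2]] := IH (size s) lt s (erefl _).
    by have := even x; rewrite dcons oddD addnn odd_double.
  exists ((a, a) :: t); split=> [x y|x]; first by rewrite !between_cons h1.
  by have := h2 x; rewrite /outs /ins /= => ->.
have [c [e es1 eb]] : exists c, exists2 e, e \in s & e = (b, c) \/ e = (c, b).
  have : 0 < outs s b + ins s b.
    have := even b; rewrite dcons eqxx (negbTE ab) add0n.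
    by case: (outs s b + ins s b).
  rewrite addn_gt0 -!has_count => /orP[] /hasP[[u v] uv /= /eqP e]; subst.
    by exists v, (b, v) => //; left.
  by exists u, (u, b) => //; right.
have flip x y : (e == (x, y)) + (e == (y, x)) = ((b, c) == (x, y)) + ((b, c) == (y, x)) :> nat.
  by case: eb => ->; rewrite // pair_flip.
have deg_e x : (e.1 == x) + (e.2 == x) = (b == x) + (c == x) :> nat.
  by case: eb => -> //=; rewrite addnC.
pose s' := (a, c) :: rem e s.
have ss' : size s' = size s.
  by rewrite /= size_rem // prednK //; case: (s) es1.
have even' x : ~~ odd (outs s' x + ins s' x).
  have := even x; rewrite dcons (outs_rem _ es1) (ins_rem _ es1) [X in _ + X]addnACA deg_e.
  rewrite /outs /ins /= addnACA !oddD.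
  case: (odd (count _ _)); case: (odd (count _ _));
  by case: (a == x); case: (b == x); case: (c == x).
have lt' : size s' < m by rewrite ss'.
have [t [h1 h2]] := IH _ lt' s' (erefl _) even'.
have bs x y : between ((a, b) :: s) x y =
    ((a, b) == (x, y)) + ((a, b) == (y, x)) +
    (((b, c) == (x, y)) + ((b, c) == (y, x)) + between (rem e s) x y).
  by rewrite between_cons (between_rem _ _ es1) flip.
have cancel f x y : f = (a, c) \/ f = (c, a) -> f \in t ->
    between (rem f t) x y = between (rem e s) x y.
  move=> ff ft; have := h1 x y; rewrite between_cons (between_rem x y ft).
  by case: ff => ->; [move/addnI | rewrite pair_flip => /addnI].
have [ft|ft] : (a, c) \in t \/ (c, a) \in t.
  have : 0 < between t a c by rewrite h1 between_cons eqxx.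
  by rewrite /between addn_gt0 -!has_count !has_pred1 => /orP.
  exists [:: (a, b), (b, c) & rem (a, c) t]; split=> [x y|x].
    by rewrite bs 2!between_cons cancel //; left.
  have := h2 x; rewrite (outs_rem _ ft) (ins_rem _ ft) /outs /ins /=.
  by move: (count _ _) (count _ _) => p q; move: (a == x) (b == x) (c == x) => [] [] []; lia.
exists [:: (c, b), (b, a) & rem (c, a) t]; split=> [x y|x].
  rewrite bs 2!between_cons cancel //; last by right.
  by rewrite pair_flip addnCA -pair_flip [in RHS]addnCA [in RHS]addnCA; congr (_ + (_ + _)); rewrite pair_flip.
have := h2 x; rewrite (outs_rem _ ft) (ins_rem _ ft) /outs /ins /=.
by move: (count _ _) (count _ _) => p q; move: (a == x) (b == x) (c == x) => [] [] []; lia.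
Qed.

Lemma outs_sum t x : outs t x = \sum_y count_mem (x, y) t.
Proof.
elim: t => [|[u v] t IH]; first by rewrite big1.
rewrite /outs /= -/(outs t x) IH big_split /=; congr (_ + _).
rewrite (bigD1 v) //= xpair_eqE eqxx andbT big1 ?addn0 // => y yv.
by rewrite xpair_eqE (eq_sym v) (negbTE yv) andbF.
Qed.

Lemma ins_sum t x : ins t x = \sum_y count_mem (y, x) t.
Proof.
elim: t => [|[u v] t IH]; first by rewrite big1.
rewrite /ins /= -/(ins t x) IH big_split /=; congr (_ + _).
rewrite (bigD1 u) //= xpair_eqE eqxx big1 ?addn0 // => y yu.
by rewrite xpair_eqE (eq_sym u) (negbTE yu).
Qed.

Lemma sum_indicator (Q : pred T) : \sum_y (Q y : nat) = #|[set y | Q y]|.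
Proof.
by rewrite -sum1_card [RHS]big_mkcond; apply: eq_bigr => y _; rewrite inE; case: (Q y).
Qed.

Lemma eulerian_orientation (E : rel T) m :
  symmetric E -> irreflexive E -> (forall x, #|[set y | E x y]| = 2 * m) ->
  exists o : rel T, [/\ forall x y, o x y || o y x = E x y,
    forall x y, ~~ (o x y && o y x),
    forall x, #|[set y | o x y]| = m & forall x, #|[set y | o y x]| = m].
Proof.
move=> sE irE reg.
pose s := [seq e <- enum {: T * T} | E e.1 e.2 && (enum_rank e.1 < enum_rank e.2)].
have cs x y : count_mem (x, y) s = (E x y && (enum_rank x < enum_rank y)).
  have us : uniq s by rewrite filter_uniq // enum_uniq.
  by rewrite (count_uniq_mem _ us) mem_filter mem_enum andbT.
have bs x y : between s x y = E x y.
  rewrite /between !cs (sE y x); case: (ltngtP (enum_rank x) (enum_rank y)) => h;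
  rewrite ?andbT ?andbF ?addn0 //.
  by rewrite (enum_rank_inj (ord_inj h)) irE.
have ds x : outs s x + ins s x = 2 * m.
  rewrite outs_sum ins_sum -big_split -(reg x) -sum_indicator; apply: eq_bigr => y _.
  exact: bs.
have [x|t [h1 h2]] := @balanced_orientation s.
  by rewrite ds mul2n odd_double.
pose o x y := (x, y) \in t.
have bt x y : between t x y = E x y by rewrite h1 bs.
have le x y : count_mem (x, y) t = o x y.
  have := bt x y; rewrite /between /o -has_pred1 has_count.
  by case: (count_mem (x, y) t) => [|[|n]] //=; case: (E x y).
have deg x : outs t x + ins t x = 2 * m.
  rewrite outs_sum ins_sum -big_split -(reg x) -sum_indicator; apply: eq_bigr => y _.
  exact: bt.
have outm x : outs t x = m by have := deg x; rewrite -h2; lia.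
exists o; split.
- move=> x y; have := bt x y; rewrite /between !le.
  by case: (o x y); case: (o y x); case: (E x y).
- move=> x y; have := bt x y; rewrite /between !le.
  by case: (o x y); case: (o y x); case: (E x y).
- by move=> x; rewrite -sum_indicator -(outm x) outs_sum; apply: eq_bigr => y _; rewrite le.
- by move=> x; rewrite -sum_indicator -(outm x) h2 ins_sum; apply: eq_bigr => y _; rewrite le.
Qed.

End Orientation.

(** * Factors of regular graphs of even degree *)

Section Petersen.
Variable T : finType.

(** The bipartite double cover is regular. Were it deficient, [two_small_components] would give an
    odd small set, impossible in a bipartite graph. A perfect matching of the cover is the
    permutation. *)
Lemma regular_digraph_permutation (o : rel T) m :
  0 < m -> (forall x, #|[set y | o x y]| = m) -> (forall x, #|[set y | o y x]| = m) ->
  exists2 f : T -> T, injective f & forall x, o x (f x).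
Proof.
move=> m0 outm inm.
pose E : rel (T + T) := fun u v =>
  match u, v with inl x, inr y => o x y | inr y, inl x => o x y | _, _ => false end.
have sE : symmetric E by move=> [x|x] [y|y].
have reg u : #|[set v | E u v]| = m.
  case: u => x.
    rewrite -(outm x) -(card_imset _ (@inr_inj T T)); apply: eq_card => -[y|y]; rewrite !inE.
      by apply/esym/imsetP=> -[].
    by rewrite mem_imset ?inE //; apply: inr_inj.
  rewrite -(inm x) -(card_imset _ (@inl_inj T T)); apply: eq_card => -[y|y]; rewrite !inE.
    by rewrite mem_imset ?inE //; apply: inl_inj.
  by apply/esym/imsetP=> -[].
have ev : ~~ odd #|{: T + T}| by rewrite card_sum addnn odd_double.
have u0 : unm E = 0.
  apply/eqP; rewrite eqn0Ngt; apply/negP=> pos.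
  have [X [_ [[_ oX outX _] _ _]]] := two_small_components sE reg m0 ev pos.
  apply: (small_not_bipartite sE (H := [set u : T + T | if u is inl _ then true else false]) reg oX outX).
  by move=> [x|x] [y|y] _ _; rewrite !inE.
have [N /andP[/matchingP[N1 N2] leN]] := exists_optimal E.
have NE u : E u (N u).
  apply: N2; move: leN; rewrite u0 leqn0 cards_eq0 => /eqP e.
  by apply: contraT; rewrite negbK => Nu; have := in_set0 u; rewrite -e inE Nu.
pose f x := if N (inl x) is inr y then y else x.
have Nf x : N (inl x) = inr (f x).
  by rewrite /f; have := NE (inl x); case: (N (inl x)).
exists f => [x y e|x]; last by have := NE (inl x); rewrite Nf.
by have /(inv_inj N1) [] : N (inl x) = N (inl y) by rewrite !Nf e.
Qed.

(** Take the cycles of a permutation along an Eulerian orientation. None has length below 3, as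
    there are no loops and each edge has one direction. *)
Lemma two_factor (E : rel T) m :
  symmetric E -> irreflexive E -> (forall x, #|[set y | E x y]| = 2 * m.+1) ->
  exists Y : rel T, [/\ symmetric Y, subrel Y E & forall x, #|[set y | Y x y]| = 2].
Proof.
move=> sE irE reg; have [o [oE oA outm inm]] := eulerian_orientation sE irE reg.
have [f injf of_] := regular_digraph_permutation (ltn0Sn m) outm inm.
exists (fun x y => (f x == y) || (f y == x)); split.
- by move=> x y; rewrite orbC.
- by move=> x y /orP[] /eqP <-; rewrite -oE of_ ?orbT.
move=> x; pose g := invF injf; have fg : f (g x) = x by apply: f_invF.
have ne : f x != g x.
  by apply: contraNneq (oA x (f x)) => e; rewrite of_ {1}e -{2}fg of_.
transitivity #|[set f x; g x]|; last by rewrite cards2 ne.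
apply: eq_card => y; rewrite !inE (eq_sym y); congr (_ || _).
by rewrite -{1}fg (inj_eq injf).
Qed.

Lemma even_factor (E : rel T) m j :
  symmetric E -> irreflexive E -> (forall x, #|[set y | E x y]| = 2 * m) -> j <= m ->
  exists Y : rel T, [/\ symmetric Y, subrel Y E & forall x, #|[set y | Y x y]| = 2 * j].
Proof.
move=> sE irE reg; elim: j => [|j IH] jm.
  by exists (fun _ _ => false); split=> // x; apply: eq_card0 => y; rewrite inE.
have [Y [sY YE degY]] := IH (ltnW jm).
pose D x y := E x y && ~~ Y x y.
have sD : symmetric D by move=> x y; rewrite /D sE sY.
have irD : irreflexive D by move=> x; rewrite /D irE.
have degD x : #|[set y | D x y]| = 2 * (m - j.+1).+1.
  rewrite (_ : (m - j.+1).+1 = m - j); last by lia.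
  have := cardsID [set y | Y x y] [set y | E x y]; rewrite reg.
  have -> : [set y | E x y] :&: [set y | Y x y] = [set y | Y x y].
    apply/setP=> y; rewrite !inE; case: (boolP (Y x y)) => h; rewrite ?andbF // andbT; exact: YE.
  have -> : [set y | E x y] :\: [set y | Y x y] = [set y | D x y].
    by apply/setP=> y; rewrite !inE andbC.
  by rewrite degY mulnBr => <-; rewrite addKn.
have [Z [sZ ZD degZ]] := two_factor sD irD degD.
exists (fun x y => Y x y || Z x y); split.
- by move=> x y; rewrite sY sZ.
- by move=> x y /orP[/YE|/ZD/andP[]].
move=> x; rewrite mulnS -(degY x) -(degZ x) addnC -cardsUI.
have -> : [set y | Y x y] :&: [set y | Z x y] = set0.
  apply/setP=> y; rewrite !inE; apply/negP=> /andP[h /ZD/andP[_]]; by rewrite h.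
by rewrite cards0 addn0; apply: eq_card => y; rewrite !inE.
Qed.

End Petersen.

(** * Assembling the factors *)

Section Assembly.
Variable T : finType.

Lemma cdeg_deg (G : sgraph T) v : cdeg G v true = deg G v.
Proof.
apply: eq_card => w; rewrite !inE; case: (eqVneq w v) => [->|_] /=.
  by rewrite adj_irrefl.
by case: (G v w).
Qed.

(** [H] consists of the noise matchings and a [2 * m]-factor of the L-graph; [G] adds the edges of
    colour R. *)
Lemma packed_factors s l m r : packed (T := T) s l r -> ~~ odd l -> 2 * m <= l ->
  exists G H : sgraph T, [/\ forall v, deg G v = r v + (s + 2 * m),
    is_factor (s + 2 * m) H G &
    exists F : 'I_s -> sgraph T, (forall i, is_factor 1 (F i) H) /\
      (forall i j, i != j -> edge_disjoint (F i) (F j))].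
Proof.
move=> [C [R [B [L [c [RB RL BL cc cs]]]]]] evl ml; subst s.
have sL := lgraph_sym cc; have irL := @lgraph_irr T C L c; have regL := lgraph_reg cc.
have [Y [sY YL degY]] : exists Y : rel T,
    [/\ symmetric Y, subrel Y (lgraph L c) & forall x, #|[set y | Y x y]| = 2 * m].
  apply: (@even_factor _ _ l./2) => //; last by lia.
  by move=> x; rewrite regL; lia.
pose colour m' : rel T := fun x y => (x != y) && (c x y == m').
have sC m' : symmetric (colour m') by move=> x y; rewrite /colour eq_sym (conf_sym cc).
have irC m' : irreflexive (colour m') by move=> x; rewrite /colour eqxx.
pose h : rel T := fun x y => (x != y) && (c x y \in noise R B L) || Y x y.
have sH : symmetric h by move=> x y; rewrite /h sY eq_sym (conf_sym cc).
have irH : irreflexive h.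
  by move=> x; rewrite /h eqxx /=; apply/negP=> /YL; rewrite irL.
pose g : rel T := fun x y => colour R x y || h x y.
have sG : symmetric g by move=> x y; rewrite /g sC sH.
have irG : irreflexive g by move=> x; rewrite /g irC irH.
have YcL x y : Y x y -> c x y = L by move=> /YL /andP[_ /eqP].
have degH v : #|[set w | h v w]| = #|noise R B L| + 2 * m.
  have -> : #|noise R B L| = #|[set w | (w != v) && (c v w \in noise R B L)]|.
    rewrite -cdeg_sum -sum1_card; apply: eq_bigr => i.
    by rewrite inE => /(conf_M cc v) ->.
  rewrite -(degY v) -cardsUI.
  rewrite [X in _ = _ + X](_ : _ = 0); last first.
    apply/eqP; rewrite cards_eq0; apply/eqP/setP=> w; rewrite !inE.
    by apply/negP=> /andP[/andP[_ nz] /YcL e]; rewrite e eqxx !orbT in nz.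
  by rewrite addn0; apply: eq_card => w; rewrite !inE /h eq_sym !inE.
have degG v : #|[set w | g v w]| = r v + (#|noise R B L| + 2 * m).
  rewrite -(degH v) -(conf_R cc v) /cdeg -cardsUI.
  rewrite [X in _ = _ + X](_ : _ = 0); last first.
    apply/eqP; rewrite cards_eq0; apply/eqP/setP=> w; rewrite !inE /h.
    apply/negP=> /andP[/andP[_ /eqP e]]; rewrite e inE !inE eqxx andbF /=.
    by move=> /YcL; rewrite e => eRL; rewrite eRL eqxx in RL.
  by rewrite addn0; apply: eq_card => w; rewrite !inE /g /colour eq_sym.
exists (SGraph sG irG), (SGraph sH irH); split=> //.
  by split=> // x y /= hxy; rewrite /g hxy orbT.
exists (fun i => SGraph (sC (enum_val i)) (irC (enum_val i))); split=> [i|i j ij].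
  have iN := enum_valP i; split=> [x y|v] /=.
    by rewrite /h /colour => /andP[-> /eqP->]; rewrite iN.
  have := iN; rewrite inE => /(conf_M cc v) <-; apply: eq_card => w.
  by rewrite !inE /= /colour eq_sym.
move=> x y /=; apply: contra ij => /andP[/andP[_ /eqP e1] /andP[_ /eqP e2]].
by apply/eqP/enum_val_inj; rewrite -e1 -e2.
Qed.

Lemma potential_factors K k r (P G : sgraph T) : ~~ odd #|T| ->
  (forall v, deg G v = deg P v + K) -> r <= k <= K -> odd r = odd k -> odd k = odd K ->
  (forall i, i < r -> admissible i (K - i)) ->
  exists G' H : sgraph T, [/\ forall v, deg G' v = deg P v + k, is_factor k H G' &
    exists F : 'I_r -> sgraph T, (forall i, is_factor 1 (F i) H) /\
      (forall i j, i != j -> edge_disjoint (F i) (F j))].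
Proof.
move=> evT dG /andP[rk kK] ork okK adm.
have dG' v : cdeg G v true = cdeg P v true + K by rewrite !cdeg_deg.
have [P1 [G1 [sP1 sG1 dP1 dG1 sub]]] := kundu (@adj_sym _ P) (@adj_sym _ G) dG'.
have rK : r + (K - r) = K by rewrite subnKC // (leq_trans rk).
have p0 : packed (T := T) 0 (r + (K - r)) (fun v => deg P v).
  rewrite rK; apply: (packed0 sP1 sG1 sub) => v; first by rewrite dP1 cdeg_deg.
  by rewrite dG1 cdeg_deg.
have pr : packed (T := T) r (K - r) (fun v => deg P v).
  by apply: packed_steps => // i ir; rewrite rK; apply: adm.
(* The remaining regular degree [K - r] is even, and [(k - r)./2] of its 2-factors complete the [r]
   matchings to degree [k]. *)
have e : r + 2 * ((k - r)./2) = k by lia.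
have ev : ~~ odd (K - r) by lia.
have le : 2 * ((k - r)./2) <= K - r by lia.
have [G' [H [h1 h2 h3]]] := packed_factors pr ev le.
by rewrite e in h1 h2; exists G', H.
Qed.

End Assembly.

(** The pairs with [2 * i > k - i + 1] are (2,1), (2,2), (3,1) and (3,3), all admissible; (3,2)
    would need [r = 4] and [k = 5], against parity. *)
Lemma admissible_small k r i :
  r <= minn k 4 -> odd r = odd k -> i < r -> admissible i (k - i).
Proof.
rewrite leq_min => /andP[rk r4] ork ir; rewrite /admissible.
have : i < 4 by apply: leq_trans ir r4.
case: i ir => [|[|[|[|//]]]] ir _; try lia.
Qed.

Theorem theorem1p13 (n : nat) (d : n.-tuple nat) (r k k' : nat)
  (n_gt0 : 0 < n) (n_even : ~~ odd n)
  (d_noninc : sorted geq d)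
  (d_pos : all (leq 1) d)
  (d_graphic : graphic d)
  (r_le_k : r <= k) (k_le_dn : k <= nth 0 d n.-1)
  (k'_le : k' <= n - 1 - nth 0 d 0)
  (k'_even : ~~ odd k')
  (r_eq_k : r = k %[mod 2])
  (dk_graphic : graphic [tuple of [seq x - k | x <- d]])
  (dk'_graphic : graphic [tuple of [seq x + k' | x <- d]])
  (r_bound : (r%:R <= Num.max (minn k 4)%:R ((k + k' + 3)%:R / 3%:R) :> rat)%R) :
  exists G : sgraph 'I_n, realizes G d /\
    exists H : sgraph 'I_n, is_factor k H G /\
      exists F : 'I_r -> sgraph 'I_n,
        (forall i, is_factor 1 (F i) H) /\
        (forall i j, i != j -> edge_disjoint (F i) (F j)).
Proof.
have [P dP] := dk_graphic.
have degs (e : n.-tuple nat) (G : sgraph 'I_n) : realizes G e -> forall v, deg G v = tnth e v.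
  by move=> <- v; rewrite tnth_mktuple.
have kd v : k <= tnth d v.
  apply: leq_trans k_le_dn _; rewrite (tnth_nth 0).
  have := sorted_leq_nth (leT := geq) (fun b a c ab bc => leq_trans bc ab) leqnn 0 d_noninc.
  apply; rewrite ?inE ?size_tuple ?ltn_predL //.
  by rewrite -ltnS prednK.
have dPv v : deg P v = tnth d v - k by rewrite (degs _ _ dP) tnth_map.
have evT : ~~ odd #|'I_n| by rewrite card_ord.
have ork : odd r = odd k by move: r_eq_k; rewrite !modn2; case: (odd r); case: (odd k).
(* The choice is [K = k] if [r] is at most [minn k 4], and [K = k + k'] under the other bound. *)
suff [K [kK oK [G dG] adm]] : exists K, [/\ k <= K, odd k = odd K,
    exists G : sgraph 'I_n, forall v, deg G v = deg P v + K &
    forall i, i < r -> admissible i (K - i)].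
  have rkK : r <= k <= K by rewrite r_le_k.
  have [G' [H [h1 h2 h3]]] := potential_factors evT dG rkK ork oK adm.
  exists G'; split; last by exists H.
  by apply: eq_from_tnth => v; rewrite tnth_mktuple h1 dPv subnK.
move: r_bound; rewrite Order.TotalTheory.le_max Num.Theory.ler_nat.
rewrite Num.Theory.ler_pdivlMr ?Num.Theory.ltr0n // -GRing.Theory.natrM Num.Theory.ler_nat.
case/orP=> le.
  exists k; split=> //; last by move=> i; apply: admissible_small.
  by have [G dG] := d_graphic; exists G => v; rewrite (degs _ _ dG) dPv subnK.
exists (k + k'); split; first exact: leq_addr.
- by rewrite oddD (negbTE k'_even) addbF.
- have [G dG] := dk'_graphic; exists G => v.
  by rewrite (degs _ _ dG) tnth_map dPv addnA subnK.
(* From [i <= r - 1] and [3 * r <= k + k' + 3] one gets [3 * i <= k + k'], enough for the core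
   condition. *)
- by move=> i ir; rewrite /admissible; apply/orP; right; apply/orP; left; lia.
Qed.
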